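(* Let $0\le\alpha<1$ and $\theta>-\alpha$, and let $P$ be the law PDP$(\alpha,\theta)$ of the two-parameter Poisson–Dirichlet process. For the Shannon entropy $\mathcal H$ put $Z^{\mathcal H}_n(\Pi)=E_{\mathbf P(\cdot\mid\pi^n)}(\mathcal H)$ for $n\in\mathbb N$ and $\Pi=(\pi^m:m\in\mathbb N)\in\mathfrak M$. Then the martingale difference is uniformly bounded: $$\sup_{n\in\mathbb N}\ \sup_{\Pi\in\mathfrak M}\left|Z^{\mathcal H}_{n+1}(\Pi)-Z^{\mathcal H}_n(\Pi)\right|<\infty .$$
   Context: $\mathbb N=\{1,2,\dots\}$. $\mathcal S^{\downarrow}=\{s=(s(i):i\in\mathbb N): s(i)\ge s(i+1)\ge 0\ \forall i,\ \sum_i s(i)=1\}$. The Shannon entropy is $\mathcal H(s)=-\sum_{i\in\mathbb N}s(i)\log s(i)$ with $0\log0=0$. PDP$(\alpha,\theta)$ is the probability law $P$ on $\mathcal S^{\downarrow}$ of the decreasing rearrangement of $(\hat\pi(j):j\in\mathbb N)$, where $\hat\pi(1)=W_1$, $\hat\pi(j)=W_j\prod_{i=1}^{j-1}(1-W_i)$ for $j\ge2$, and the $W_j$ are independent with $W_j\sim\mathrm{Beta}(1-\alpha,\theta+\alpha j)$. Let $S\sim P$, and let $(X_l:l\ge1)$ be i.i.d. uniform on $[0,1]$, independent of $S$. To $s\in\mathcal S^{\downarrow}$ one associates disjoint open subintervals of $[0,1]$ whose lengths ranked decreasingly are $s$. Two individuals $X_l,X_m$ are of the same species if they fall in the same interval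 associated with $S$; species are numbered $1,2,\dots$ in order of first appearance. $k^n$ is the number of species among $X_1,\dots,X_n$, $\pi^n(j)$ is the number of the first $n$ individuals in the $j$-th discovered species, and $\pi^n=(\pi^n(1),\dots,\pi^n(k^n))$. $\mathbf P$ is the joint law of $S$ and $(\pi^n:n\in\mathbb N)$. $\mathfrak M$ is the set of all possible trajectories $\Pi=(\pi^n:n\in\mathbb N)$: $\pi^1=(1)$, and $\pi^{n+1}$ is obtained from $\pi^n$ either by adding $1$ to one coordinate or by appending a new coordinate equal to $1$, i.e. $\pi^{n+1}=(\pi^n,1)$. For a given value of $\pi^n$ (each has positive probability), $E_{\mathbf P(\cdot\mid\pi^n)}(\mathcal H)$ is the conditional expectation of $\mathcal H(S)$ given that value of the abundance vector at step $n$. *)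

(* Defs.v *)
From HB Require Import structures.
From mathcomp Require Import all_boot all_order all_algebra finmap.
From mathcomp Require Import all_classical all_reals all_analysis.

Set Implicit Arguments.
Unset Strict Implicit.
Unset Printing Implicit Defensive.

Import Order.TTheory GRing.Theory Num.Theory.
Import numFieldNormedType.Exports.

Local Open Scope classical_set_scope.
Local Open Scope ring_scope.

(* Sequences indexed by {1, 2, ...} in the mathematics are indexed by nat,
   hence shifted by one: [s i] is s(i+1), [W j] is W_{j+1}, [X l] is X_{l+1}.
   The sample size n, in contrast, is never shifted. *)

Record ranked_simplex (R : realType) := RankedSimplex {
  mass :> nat -> R;
  mass_nonincreasing : forall i, mass i.+1 <= mass i;
  mass_ge0 : forall i, 0 <= mass i;
  mass_sum : (\sum_(0 <= i <oo) (mass i)%:E = 1)%E }.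

HB.instance Definition _ (R : realType) := gen_eqMixin (ranked_simplex R).
HB.instance Definition _ (R : realType) := gen_choiceMixin (ranked_simplex R).

Section ranked_simplex_measurable.
Variable R : realType.

Lemma unit_mass_nonincreasing i : ((i.+1 == 0%N)%:R : R) <= (i == 0%N)%:R.
Proof. by rewrite ler0n. Qed.

Lemma unit_mass_ge0 i : (0 : R) <= (i == 0%N)%:R.
Proof. by rewrite ler0n. Qed.

Lemma unit_mass_sum : (\sum_(0 <= i <oo) ((i == 0%N)%:R : R)%:E = 1)%E.
Proof.
rewrite (nneseries_split 0%N 1%N); last by move=> k _; rewrite lee_fin ler0n.
rewrite add0n big_nat1 eseries0 ?adde0 // => i.
by case: i.
Qed.

Definition unit_mass : ranked_simplex R :=
  RankedSimplex unit_mass_nonincreasing unit_mass_ge0 unit_mass_sum.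

HB.instance Definition _ := isPointed.Build (ranked_simplex R) unit_mass.

Definition coordinate_events : set (set (ranked_simplex R)) :=
  \bigcup_i preimage_set_system setT (fun s : ranked_simplex R => s i)
    measurable.

HB.instance Definition _ := @isMeasurable.Build (sigma_display coordinate_events)
  (ranked_simplex R) <<s coordinate_events >>
  (@sigma_algebra0 _ setT coordinate_events)
  (@sigma_algebraC _ coordinate_events)
  (@sigma_algebra_bigcup _ setT coordinate_events).

End ranked_simplex_measurable.

Definition shannon_entropy (R : realType) (s : ranked_simplex R) : \bar R :=
  (- \sum_(0 <= i <oo) (s i * ln (s i))%:E)%E.

(* [beta_prob] only takes natural parameters. *)
Section real_beta.
Variables (R : realType) (a b : R).

Definition beta_kernel (x : R) : R := x `^ (a - 1) * (1 - x) `^ (b - 1).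

Definition real_beta_fun : R :=
  \int[lebesgue_measure]_(x in `]0, 1[) beta_kernel x.

Definition real_beta_law (U : set R) : \bar R :=
  (\int[lebesgue_measure]_(x in U `&` `]0%R, 1%R[)
    (beta_kernel x / real_beta_fun)%:E)%E.

End real_beta.

Definition mutually_independent (R : realType) (d d' : measure_display)
    (T : measurableType d) (T' : measurableType d') (P : probability T R)
    (X : nat -> {RV P >-> T'}) : Prop :=
  forall (J : {fset nat}) (A : nat -> set T'), (forall j, measurable (A j)) ->
    P (\bigcap_(j in [set` J]) (X j @^-1` A j)) =
    (\prod_(j <- J) P (X j @^-1` A j))%E.

(* Independence of a random element from a whole sequence; the rectangles
   below form a pi-system generating the sigma-algebra of the sequence. *)
Definition independent_of_sequence (R : realType) (d d1 d2 : measure_display)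
    (T : measurableType d) (T1 : measurableType d1) (T2 : measurableType d2)
    (P : probability T R) (S : {RV P >-> T1}) (X : nat -> {RV P >-> T2}) : Prop :=
  forall (B : set T1) (J : {fset nat}) (A : nat -> set T2),
    measurable B -> (forall j, measurable (A j)) ->
    P (S @^-1` B `&` \bigcap_(j in [set` J]) (X j @^-1` A j)) =
    (P (S @^-1` B) * P (\bigcap_(j in [set` J]) (X j @^-1` A j)))%E.

Definition stick_breaking (R : realType) (w : nat -> R) (j : nat) : R :=
  w j * \prod_(i < j) (1 - w i).

(* A bijective rearrangement exists almost surely for stick-breaking weights,
   because these are almost surely all positive. *)
Definition is_ranking_of (R : realType) (p : nat -> R) (s : ranked_simplex R) :
    Prop :=
  exists2 sigma : nat -> nat, bijective sigma & forall i, s i = p (sigma i).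

(* [P] is PDP(alpha, theta).  The ranking is required only almost surely since
   the weights are positive and sum to 1 only almost surely. *)
Definition is_PDP (R : realType) (alpha theta : R)
    (P : probability (ranked_simplex R) R) : Prop :=
  exists (d : measure_display) (T : measurableType d) (Q : probability T R)
    (W : nat -> {RV Q >-> R}) (V : {RV Q >-> ranked_simplex R}),
    [/\ mutually_independent W,
        forall j (U : set R), measurable U ->
          distribution Q (W j) U =
          real_beta_law (1 - alpha) (theta + alpha * j.+1%:R) U,
        {ae Q, forall t, is_ranking_of (stick_breaking (fun j => W j t)) (V t)}
      & forall A, measurable A -> P A = distribution Q V A].

Definition species_interval (R : realType)
    (a : nat -> ranked_simplex R -> R) (s : ranked_simplex R) (i : nat) : set R :=
  [set` `]a i s, (a i s + s i)[ ].

(* A measurable choice, for every [s], of disjoint open intervals of [0, 1]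
   with lengths [s]; [a i s] is the left endpoint of the i-th longest one
   (an empty interval when [s i = 0]). *)
Definition interval_placement (R : realType)
    (a : nat -> ranked_simplex R -> R) : Prop :=
  [/\ forall i, measurable_fun setT (a i),
      forall s i, species_interval a s i `<=` `[0, 1]
    & forall s, trivIset setT (species_interval a s)].

(* An individual outside all the intervals, an event of probability zero,
   forms a species of its own. *)
Definition same_species (R : realType) (a : nat -> ranked_simplex R -> R)
    (s : ranked_simplex R) (x : nat -> R) (l m : nat) : bool :=
  (l == m) ||
  `[< exists i, species_interval a s i (x l) /\ species_interval a s i (x m) >].

(* Sizes of the classes of [e] among the first [n] individuals, in order of
   first appearance; [l] discovers a class iff no earlier [m] is in it. *)
Definition abundance (e : rel nat) (n : nat) : seq nat :=
  [seq count (e l) (iota 0 n)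
  | l <- iota 0 n & ~~ has (fun m => e m l) (iota 0 l)].

(* [Pi n] is the abundance vector at step n >= 1; [Pi 0] is irrelevant. *)
Definition trajectory (Pi : nat -> seq nat) : Prop :=
  Pi 1%N = [:: 1%N] /\
  forall n, (1 <= n)%N ->
    Pi n.+1 = rcons (Pi n) 1%N \/
    exists2 j, (j < size (Pi n))%N & Pi n.+1 = incr_nth (Pi n) j.

(* Expectation of [f] under P( . | A), for an event [A] of positive
   probability. *)
Definition cond_expectation (R : realType) (d : measure_display)
    (T : measurableType d) (P : probability T R) (A : set T) (f : T -> \bar R) :
    \bar R :=
  (((fine (P A))^-1)%:E * \int[P]_(t in A) f t)%E.

Definition entropy_estimate (R : realType) (d : measure_display)
    (T : measurableType d) (P : probability T R)
    (S : {RV P >-> ranked_simplex R}) (X : nat -> {RV P >-> R})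
    (a : nat -> ranked_simplex R -> R) (n : nat) (Pi : nat -> seq nat) :
    \bar R :=
  cond_expectation P
    [set t | abundance (same_species a (S t) (fun l => X l t)) n = Pi n]
    (fun t => shannon_entropy (S t)).

(* Main.v *)
Require Import Defs.
From HB Require Import structures.
From mathcomp Require Import all_boot all_order all_algebra finmap.
From mathcomp Require Import all_classical all_reals all_analysis.
From mathcomp Require Import measurable_realfun.
From mathcomp Require Import ring lra zify.

(** Let [r] be an abundance vector with [k] classes and [n] individuals, and let
[m_r(s)] be the sum of [s(x_1)^(r_1) ... s(x_k)^(r_k)] over pairwise distinct
[x_1, ..., x_k].  Given [S = s], the vector [r] is observed with probability
[K * m_r(s)], where the positive number [K] counts the ways of building [r] one
individual at a time and does not depend on [s] ([integral_abundance_event],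
[word_count_gt0]).  By Bayes' formula the estimate at [r] is therefore the quotient of
the integrals of [H * m_r] and of [m_r] under PDP(alpha, theta), which turns out
to be explicit.

The denominator is Pitman's exchangeable partition probability function.
Splitting off the first stick of the stick-breaking sequence gives a recursion
from the parameter [theta] to [theta + alpha].  The closed formula satisfies the same
recursion, and the difference of two bounded solutions is contracted by factors
at most [1 - c/N], whose product is zero, hence vanishes ([harmonic_contraction],
[expected_sum_eppf]).

For the numerator, expand [- x log x] as the sum over [m >= 1] of
[x (1 - x)^m / m] and stop at [m = M].  The product of [m_r] with a sum of
[x (1 - x)^m] is again a combination of sums over distinct indices, and powers of
[1 - x] are removed by [x^a (1 - x)^b = x^(a+1) (1 - x)^b + x^a (1 - x)^(b+1)].
The quotient becomes a mixture, with the predictive weights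
[(theta + k alpha) / (theta + n)] for a new species and
[(r_j - alpha) / (theta + n)] for the j-th one, of partial sums [log_moment] of
differences [psi(theta + n + 1) - psi(x)] of the digamma function
([integral_PDP_truncated_entropy]).

The partial sums obey the exact shift rules of the digamma function up to a
factor in [[0, 1]]: moving either argument by one changes them by at most the
inverse of that argument, and they grow at most linearly in [n].  One more
individual changes the unnormalized mixture by at most a constant plus one such
partial sum, and the normalization [theta + n] by one, so that the quotients
differ by at most [2 / (1 - alpha) + 1], whatever [r] and [M]
([posterior_mean_increment]).  Monotone convergence in [M] finishes the proof. *)

Set Implicit Arguments.
Unset Strict Implicit.
Unset Printing Implicit Defensive.

Import Order.TTheory GRing.Theory Num.Theory.
Import numFieldNormedType.Exports.

Local Open Scope classical_set_scope.
Local Open Scope ring_scope.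

(** * Sums over distinct indices *)

Section distinct_sum_def.
Variable R : realType.
Implicit Types (p : nat -> R) (es : seq (nat * nat)).

(** A class of [e.1] individuals in a species of mass [x] has probability [x ^ e.1]; the
powers of [1 - x] come from expanding the logarithm.  The absolute values make every slot nonnegative, so that series of slots need no
hypothesis to be summed in any order. *)
Definition slot (e : nat * nat) (x : R) : R := `|x| ^+ e.1 * `|1 - x| ^+ e.2.

Definition zero_at (x : nat) p : nat -> R := fun y => if y == x then 0 else p y.

(** Zeroing the entry that has been used makes the later slots vanish there as soon
as their powers are positive; this is how distinctness of the indices is encoded. *)
Fixpoint distinct_sum es p : \bar R :=
  if es is e :: es' then
    (\sum_(0 <= x <oo) (slot e (p x))%:E * distinct_sum es' (zero_at x p))%E
  else 1%E.

Definition slot_sum (e : nat * nat) p : \bar R :=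
  (\sum_(0 <= x <oo) (slot e (p x))%:E)%E.

Definition positive_powers es := all (fun e => (0 < e.1)%N) es.

Lemma slot_ge0 e x : 0 <= slot e x.
Proof. by rewrite mulr_ge0// exprn_ge0. Qed.

Lemma slot0 e : (0 < e.1)%N -> slot e 0 = 0.
Proof. by move=> e0; rewrite /slot normr0 expr0n gtn_eqF// mul0r. Qed.

Lemma distinct_sum_ge0 es p : (0 <= distinct_sum es p)%E.
Proof.
elim: es p => //= e es ih p; apply: nneseries_ge0 => x _ _.
by rewrite mule_ge0// lee_fin slot_ge0.
Qed.

Lemma slot_sum_ge0 e p : (0 <= slot_sum e p)%E.
Proof. by apply: nneseries_ge0 => x _ _; rewrite lee_fin slot_ge0. Qed.

End distinct_sum_def.

Ltac nonneg := repeat (first [ done | exact: distinct_sum_ge0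
  | exact: slot_sum_ge0 | (rewrite lee_fin; exact: slot_ge0) | apply: mule_ge0
  | apply: adde_ge0 | (apply: sume_ge0 => ? ?) | (intro)]).

Section distinct_sum.
Variable R : realType.
Implicit Types (p : nat -> R) (es : seq (nat * nat)).

Lemma nneseries_bij (sigma : nat -> nat) (f : nat -> \bar R) :
  bijective sigma -> (forall x, (0 <= f x)%E) ->
  (\sum_(0 <= x <oo) f (sigma x) = \sum_(0 <= x <oo) f x)%E.
Proof.
move=> sb f0; rewrite !nneseries_esumT//.
by rewrite [RHS](reindex_esum setT setT sigma)// setTT_bijective.
Qed.

Lemma distinct_sum_bij (sigma : nat -> nat) es p : bijective sigma ->
  distinct_sum es (p \o sigma) = distinct_sum es p.
Proof.
move=> sb; elim: es p => //= e es ih p.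
rewrite -[RHS](nneseries_bij sb)/=; last first.
  by move=> x; rewrite mule_ge0 ?distinct_sum_ge0// lee_fin slot_ge0.
apply: eq_eseriesr => x _; congr (_ * _)%E; rewrite -[RHS]ih; congr distinct_sum.
apply/funext => y; rewrite /zero_at/=.
by rewrite (inj_eq (bij_inj sb)).
Qed.

(** The slots of the sum of [s(x_1)^(r_1) ... s(x_k)^(r_k)] over distinct [x_j]. *)
Definition powers (rs : seq nat) : seq (nat * nat) := [seq (r, 0%N) | r <- rs].

Lemma distinct_sum_scale c rs p :
  distinct_sum (powers rs) (fun x => c * p x) =
  ((`|c| ^+ sumn rs)%:E * distinct_sum (powers rs) p)%E.
Proof.
elim: rs p => [|r rs ih] p /=; first by rewrite expr0 mule1.
rewrite -nneseriesZl; last first.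
  by move=> x _; rewrite mule_ge0 ?distinct_sum_ge0// lee_fin slot_ge0.
apply: eq_eseriesr => x _.
have -> : zero_at x (fun x => c * p x) = fun y => c * zero_at x p y.
  by apply/funext => y; rewrite /zero_at; case: eqP; rewrite ?mulr0.
rewrite ih !muleA -!EFinM; congr (_%:E * _)%E.
by rewrite /slot/= !expr0 !mulr1 normrM exprMn exprD mulrAC.
Qed.

Definition scons (w : R) p : nat -> R := fun x => if x is y.+1 then p y else w.

Lemma nneseries_scons (f : nat -> \bar R) : (forall x, (0 <= f x)%E) ->
  (\sum_(0 <= x <oo) f x = f 0%N + \sum_(0 <= x <oo) f x.+1)%E.
Proof.
move=> f0; rewrite nneseries_recl//; congr (_ + _)%E.
rewrite -(nneseries_addn 1%N)//.
by under eq_eseriesr do rewrite addn1.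
Qed.

Definition remove (T : Type) (s : seq T) (j : nat) := take j s ++ drop j.+1 s.

(** Since the indices are distinct, a new first entry is used by at most one slot. *)
Lemma distinct_sum_scons es w p : positive_powers es ->
  (distinct_sum es (scons w p) = distinct_sum es p +
    \sum_(j < size es) (slot (nth (0, 0)%N es j) w)%:E * distinct_sum (remove es j) p)%E.
Proof.
elim: es w p => [|e es ih] w p /=; first by rewrite big_ord0 adde0.
move=> /andP[e0 es0].
rewrite nneseries_scons; last first.
  by move=> x; rewrite mule_ge0 ?distinct_sum_ge0// lee_fin slot_ge0.
have -> : zero_at 0 (scons w p) = scons 0 p by apply/funext => -[].
have z x : zero_at x.+1 (scons w p) = scons w (zero_at x p).
  by apply/funext => -[].
rewrite ih// big1 ?adde0; last first.
  move=> j _; rewrite slot0 ?mul0e//.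
  by apply: (allP es0); apply: mem_nth.
under eq_eseriesr => x _.
  rewrite z ih// ge0_muleDr ?distinct_sum_ge0//; last first.
    by apply: sume_ge0 => j _; rewrite mule_ge0 ?distinct_sum_ge0// lee_fin slot_ge0.
  rewrite ge0_sume_distrr; last first.
    by move=> j _; rewrite mule_ge0 ?distinct_sum_ge0// lee_fin slot_ge0.
  over.
rewrite nneseriesD; last 2 first.
- by move=> x _ _; rewrite mule_ge0 ?distinct_sum_ge0// lee_fin slot_ge0.
- move=> x _ _; apply: sume_ge0 => j _.
  by rewrite !mule_ge0 ?distinct_sum_ge0// lee_fin slot_ge0.
rewrite nneseries_sum; last first.
  by move=> j x _; rewrite !mule_ge0 ?distinct_sum_ge0// lee_fin slot_ge0.
rewrite big_ord_recl/= addeCA; congr (_ + _)%E; congr (_ + _)%E.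
  by rewrite /remove/= drop0.
apply: eq_bigr => j _.
rewrite -nneseriesZl; last first.
  by move=> x _; rewrite mule_ge0 ?distinct_sum_ge0// lee_fin slot_ge0.
by apply: eq_eseriesr => x _; rewrite muleCA.
Qed.

(** The total mass is only bounded by one: this is stable under zeroing entries, and
stick-breaking weights satisfy it without an argument that they exhaust the mass. *)
Definition distribution_like p := (forall x, 0 <= p x) /\ (\sum_(0 <= x <oo) (p x)%:E <= 1)%E.

Lemma zero_at_like x p : distribution_like p -> distribution_like (zero_at x p).
Proof.
move=> [p0 p1]; have z0 y : 0 <= zero_at x p y by rewrite /zero_at; case: eqP.
split=> //; apply: le_trans p1; apply: lee_nneseries => y _; rewrite lee_fin//.
by rewrite /zero_at; case: eqP.
Qed.

Lemma distribution_like_le1 p x : distribution_like p -> p x <= 1.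
Proof.
move=> [p0 p1]; rewrite -lee_fin; apply: le_trans p1.
rewrite (@nneseriesD1 _ _ x)//; last by move=> y _; rewrite lee_fin.
by rewrite leeDl// nneseries_ge0// => y _ _; rewrite lee_fin.
Qed.

Lemma slot_le e (x : R) : (0 < e.1)%N -> 0 <= x <= 1 -> slot e x <= x.
Proof.
move=> e0 /andP[x0 x1]; rewrite /slot (ger0_norm x0) ger0_norm ?subr_ge0//.
case: (e.1) e0 => // n _; rewrite exprS -mulrA ler_piMr//.
rewrite mulr_ile1 ?exprn_ge0 ?subr_ge0// exprn_ile1// ?subr_ge0//.
by rewrite lerBlDl lerDr.
Qed.

Lemma slot_sum_le1 e p : (0 < e.1)%N -> distribution_like p -> (slot_sum e p <= 1)%E.
Proof.
move=> e0 pl; apply: (le_trans _ pl.2); apply: lee_nneseries => x _.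
  by rewrite lee_fin slot_ge0.
by rewrite lee_fin slot_le// pl.1 distribution_like_le1.
Qed.

Lemma distinct_sum_le1 es p : positive_powers es -> distribution_like p ->
  (distinct_sum es p <= 1)%E.
Proof.
elim: es p => //= e es ih p /andP[e0 es0] pl.
apply: le_trans (slot_sum_le1 e0 pl); apply: lee_nneseries => x _.
  by rewrite mule_ge0 ?distinct_sum_ge0// lee_fin slot_ge0.
rewrite -[leRHS]mule1 lee_wpmul2l ?lee_fin ?slot_ge0// ih//.
  exact: zero_at_like.
Qed.

Lemma slotM e e' (x : R) : slot e x * slot e' x = slot (e.1 + e'.1, e.2 + e'.2)%N x.
Proof. by rewrite /slot/= !exprD mulrACA. Qed.

Definition raise es (j : nat) (e : nat * nat) :=
  let e' := nth (0, 0)%N es j in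
  take j es ++ ((e.1 + e'.1, e.2 + e'.2)%N : nat * nat) :: drop j.+1 es.

(** The index of the additional slot is either different from all the others or equal
to that of one slot [j], and in this case the exponents add up. *)
Lemma slot_sum_mul e es p : (0 < e.1)%N -> positive_powers es -> distribution_like p ->
  (slot_sum e p * distinct_sum es p = distinct_sum (rcons es e) p +
    \sum_(j < size es) distinct_sum (raise es j e) p)%E.
Proof.
move=> e0; elim: es p => [|g es ih] p /=.
  move=> _ pl; rewrite mule1 big_ord0 adde0 /slot_sum.
  by apply: eq_eseriesr => x _; rewrite mule1.
move=> /andP[g0 es0] pl.
have fs : slot_sum e p \is a fin_num.
  by rewrite ge0_fin_numE ?slot_sum_ge0// (le_lt_trans (slot_sum_le1 e0 pl))// ltry.
have split x : slot_sum e p = ((slot e (p x))%:E + slot_sum e (zero_at x p))%E.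
  rewrite /slot_sum (@nneseriesD1 _ _ x)//; last by move=> y _; rewrite lee_fin slot_ge0.
  congr (_ + _)%E; rewrite eseries_mkcond; apply: eq_eseriesr => y _.
  by rewrite /zero_at; case: eqP => //= _; rewrite slot0.
rewrite -{1}(fineK fs) -nneseriesZl; last first.
  by move=> x _; rewrite mule_ge0 ?distinct_sum_ge0// lee_fin slot_ge0.
under eq_eseriesr => x _.
  rewrite fineK// (split x) muleCA ge0_muleDl; [|by nonneg..].
  rewrite ih//; last exact: zero_at_like.
  rewrite ge0_muleDr; [|by nonneg..].
  rewrite ge0_muleDr; [|by nonneg..].
  rewrite ge0_sume_distrr; last by nonneg.
  rewrite muleA -EFinM mulrC slotM.
  over.
rewrite nneseriesD; [|by nonneg..].
rewrite nneseriesD; [|by nonneg..].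
rewrite nneseries_sum; last by nonneg.
rewrite big_ord_recl/= addeCA; congr (_ + _)%E.
by case: (es).
Qed.

(** Multiply one slot by [1 = x + (1 - x)]. *)
Lemma distinct_sum_slotD es1 a b es2 p : (forall x, 0 <= p x <= 1) ->
  (distinct_sum (es1 ++ (a, b) :: es2) p =
   distinct_sum (es1 ++ (a.+1, b) :: es2) p +
   distinct_sum (es1 ++ (a, b.+1) :: es2) p)%E.
Proof.
elim: es1 p => [|e es1 ih] p p01 /=; rewrite -nneseriesD; try by nonneg.
- apply: eq_eseriesr => x _; rewrite -ge0_muleDl ?lee_fin ?slot_ge0//.
  congr (_ * _)%E; rewrite -EFinD; congr (_%:E); rewrite /slot/=.
  have /andP[px0 px1] := p01 x.
  by rewrite !exprS ger0_norm// ger0_norm ?subr_ge0//; ring.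
- apply: eq_eseriesr => x _; rewrite -ge0_muleDr ?distinct_sum_ge0//.
  rewrite ih// => y; rewrite /zero_at; case: eqP => // _.
  by rewrite lexx ler01.
Qed.

Lemma measurable_slot e : measurable_fun setT (@slot R e).
Proof.
apply: measurable_funM; first exact: (measurable_funX e.1 (@normr_measurable R _)).
apply: (@measurable_funX _ _ _ _ (fun x : R => `|1 - x|)).
apply: (measurableT_comp (@normr_measurable R setT)).
by apply: measurable_funB; [exact: measurable_cst|exact: measurable_id].
Qed.

Lemma measurable_distinct_sum d (T : measurableType d) es (p : T -> nat -> R) :
  (forall x, measurable_fun setT (p ^~ x)) ->
  measurable_fun setT (fun t => distinct_sum es (p t)).
Proof.
elim: es p => [|e es ih] p mp /=; first exact: measurable_cst.
apply: ge0_emeasurable_sum => //.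
  by move=> x t _ _; rewrite mule_ge0 ?distinct_sum_ge0// lee_fin slot_ge0.
move=> x _; apply: emeasurable_funM; last first.
  apply: (ih (fun t => zero_at x (p t))) => y; rewrite /zero_at.
  by case: eqP => _; [exact: measurable_cst|exact: mp].
by apply/measurable_EFinP; apply: measurableT_comp (mp x); exact: measurable_slot.
Qed.

End distinct_sum.

(** * Words of species and abundance vectors *)

Section word_sum.
Variable R : realType.
Implicit Types (p : nat -> R) (G : seq nat -> \bar R) (c : seq nat).
Local Open Scope ereal_scope.

(** The iterated form of a sum over all words of length [n] allows inductions on
either end of the word. *)
Fixpoint word_sum n G : \bar R :=
  if n is n'.+1 then \sum_(0 <= x <oo) word_sum n' (fun c => G (x :: c))
  else G [::].

Lemma word_sum_ge0 n G : (forall c, 0 <= G c) -> 0 <= word_sum n G.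
Proof.
elim: n G => //= n ih G G0; apply: nneseries_ge0 => x _ _.
by apply: ih => c; exact: G0.
Qed.

Lemma eq_word_sum n G1 G2 : (forall c, size c = n -> G1 c = G2 c) ->
  word_sum n G1 = word_sum n G2.
Proof.
elim: n G1 G2 => /= [|n ih] G1 G2 G12; first exact: G12.
by apply: eq_eseriesr => x _; apply: ih => c cn; apply: G12 => /=; rewrite cn.
Qed.

Lemma word_sumZl n (k : R) G : (forall c, 0 <= G c) ->
  word_sum n (fun c => k%:E * G c) = k%:E * word_sum n G.
Proof.
elim: n G => //= n ih G G0; rewrite -nneseriesZl.
  by apply: eq_eseriesr => x _; rewrite ih// => c; exact: G0.
by move=> x _; apply: word_sum_ge0.
Qed.

Lemma word_sumD n G1 G2 : (forall c, 0 <= G1 c) -> (forall c, 0 <= G2 c) ->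
  word_sum n (fun c => G1 c + G2 c) = word_sum n G1 + word_sum n G2.
Proof.
elim: n G1 G2 => //= n ih G1 G2 G10 G20; rewrite -nneseriesD.
- by apply: eq_eseriesr => x _; rewrite ih.
- by move=> x _ _; apply: word_sum_ge0.
- by move=> x _ _; apply: word_sum_ge0.
Qed.

Lemma word_sum_sum n m (G : 'I_m -> seq nat -> \bar R) : (forall j c, 0 <= G j c) ->
  word_sum n (fun c => \sum_(j < m) G j c) = \sum_(j < m) word_sum n (G j).
Proof.
move=> G0; elim: n G G0 => //= n ih G G0; rewrite -nneseries_sum.
  by apply: eq_eseriesr => x _; rewrite ih// => j c.
by move=> j x _; apply: word_sum_ge0.
Qed.

Lemma word_sum_rcons n G :
  word_sum n.+1 G = word_sum n (fun c => \sum_(0 <= x <oo) G (rcons c x)).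
Proof.
by elim: n G => //= n ih G; apply: eq_eseriesr => x _; exact: (ih (fun c => G (x :: c))).
Qed.

(** Used for a new letter, which either repeats one of the distinct letters of [s] or
is new. *)
Lemma nneseries_notin (s : seq nat) (f : nat -> \bar R) : uniq s ->
  (forall x, 0 <= f x) ->
  \sum_(0 <= x <oo) f x =
  \sum_(x <- s) f x + \sum_(0 <= x <oo) (x \notin s)%:R%:E * f x.
Proof.
move=> + f0; elim: s => [|y s ih] /=.
  by move=> _; rewrite big_nil add0e; apply: eq_eseriesr => x _; rewrite mul1e.
move=> /andP[ys us]; rewrite ih// big_cons.
rewrite (@nneseriesD1 _ _ y)//; last by move=> x _; rewrite mule_ge0.
rewrite ys mul1e addeCA addeA; congr (_ + _).
rewrite eseries_mkcond; apply: eq_eseriesr => x _.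
by rewrite in_cons; case: eqP => //= _; rewrite mul0e.
Qed.

End word_sum.

Section word_sum_distinct.
Variable R : realType.
Implicit Types (p : nat -> R) (c : seq nat).
Local Open Scope ereal_scope.

Definition monomial p (r : seq nat) c : R :=
  (\prod_(j < size r) p (nth 0%N c j) ^+ nth 0%N r j)%R.

Lemma monomial_ge0 p r c : (forall x, (0 <= p x)%R) -> (0 <= monomial p r c)%R.
Proof. by move=> p0; apply: prodr_ge0 => j _; rewrite exprn_ge0. Qed.

(** A repeated letter meets an entry that was zeroed, which kills the monomial. *)
Lemma word_sum_distinct_sum p r : (forall x, (0 <= p x)%R) -> all (ltn 0%N) r ->
  word_sum (size r) (fun c => ((uniq c)%:R * monomial p r c)%:E) =
  distinct_sum (powers r) p.
Proof.
elim: r p => [|r rs ih] p p0 /=; first by rewrite /monomial big_ord0 mulr1.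
move=> /andP[r0 rs0]; apply: eq_eseriesr => x _.
have z0 y : (0 <= zero_at x p y)%R by rewrite /zero_at; case: eqP.
rewrite -ih// -word_sumZl; last first.
  by move=> c; rewrite lee_fin mulr_ge0// monomial_ge0.
apply: eq_word_sum => c cn; rewrite -EFinM; congr (_%:E).
rewrite /monomial big_ord_recl/= /slot/= expr0 mulr1 ger0_norm//.
have [xc|xc] := boolP (x \in c); last first.
  rewrite /= mulrCA; congr (_ * (_ * _))%R; apply: eq_bigr => j _.
  rewrite /zero_at ifN//; apply: contra xc => /eqP <-.
  by rewrite mem_nth// cn.
have xi : (index x c < size rs)%N by rewrite -cn index_mem.
rewrite /= mul0r (bigD1 (Ordinal xi))//= nth_index// /zero_at eqxx.
rewrite expr0n gtn_eqF ?mul0r ?mulr0//.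
by apply: (allP rs0); apply: mem_nth.
Qed.

End word_sum_distinct.

Section species.

(** [undup] keeps the last occurrences; the two reversals make them first ones. *)
Definition discovered (c : seq nat) : seq nat := rev (undup (rev c)).

Definition species_counts (c : seq nat) : seq nat :=
  [seq count_mem x c | x <- discovered c].

Lemma discovered_rcons c x :
  discovered (rcons c x) = if x \in c then discovered c else rcons (discovered c) x.
Proof.
rewrite /discovered rev_rcons /= mem_rev; case: ifP => // _.
by rewrite rev_cons.
Qed.

Lemma mem_discovered c : discovered c =i c.
Proof. by move=> x; rewrite mem_rev mem_undup mem_rev. Qed.

Lemma discovered_uniq c : uniq (discovered c).
Proof. by rewrite rev_uniq undup_uniq. Qed.

Lemma species_counts_rcons c x : species_counts (rcons c x) =
  if x \in c then incr_nth (species_counts c) (index x (discovered c))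
  else rcons (species_counts c) 1%N.
Proof.
have countE y : count_mem y (rcons c x) = (count_mem y c + (x == y))%N.
  by rewrite -cats1 count_cat/= addn0.
rewrite /species_counts discovered_rcons; case: ifP => xc; last first.
  rewrite map_rcons countE eqxx (count_memPn (negbT xc)).
  congr rcons; apply/eq_in_map => y; rewrite mem_discovered => yc.
  by rewrite countE; case: eqP => [xy|]; [rewrite xy yc in xc|rewrite addn0].
have xi : (index x (discovered c) < size (discovered c))%N.
  by rewrite index_mem mem_discovered.
apply: (@eq_from_nth _ 0%N) => [|j]; rewrite size_map.
  by rewrite size_incr_nth size_map xi.
move=> js; rewrite nth_incr_nth !(nth_map 0%N)// countE addnC.
congr (nat_of_bool _ + _)%N; apply/eqP/eqP => [->|<-].
  by rewrite index_uniq// discovered_uniq.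
by rewrite nth_index// mem_discovered.
Qed.

Lemma abundance_species_counts c :
  abundance (fun l m => nth 0%N c l == nth 0%N c m) (size c) = species_counts c.
Proof.
have H : [seq nth 0%N c l | l <- iota 0 (size c) &
    ~~ has (fun m => nth 0%N c m == nth 0%N c l) (iota 0 l)] = discovered c.
  elim/last_ind: c => // c x ih.
  rewrite size_rcons -addn1 iotaD add0n/= filter_cat map_cat/=.
  rewrite discovered_rcons.
  have -> : [seq nth 0%N (rcons c x) l | l <- iota 0 (size c) &
    ~~ has (fun m => nth 0%N (rcons c x) m == nth 0%N (rcons c x) l) (iota 0 l)] = discovered c.
    rewrite -ih; have -> : [seq l <- iota 0 (size c) |
      ~~ has (fun m => nth 0%N (rcons c x) m == nth 0%N (rcons c x) l) (iota 0 l)] =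
      [seq l <- iota 0 (size c) |
      ~~ has (fun m => nth 0%N c m == nth 0%N c l) (iota 0 l)].
      apply: eq_in_filter => l; rewrite mem_iota add0n/= => lc.
      congr (~~ _); apply: eq_in_has => m; rewrite mem_iota add0n/= => ml.
      by rewrite !nth_rcons lc (ltn_trans ml lc).
    apply/eq_in_map => l; rewrite mem_filter mem_iota add0n/= => /andP[_ lc].
    by rewrite nth_rcons lc.
  have -> : has (fun m => nth 0%N (rcons c x) m == nth 0%N (rcons c x) (size c))
      (iota 0 (size c)) = (x \in c).
    rewrite nth_rcons ltnn eqxx; apply/hasP/idP => [[m]|xc].
      rewrite mem_iota add0n/= => mc; rewrite nth_rcons mc => /eqP <-.
      exact: mem_nth.
    exists (index x c); first by rewrite mem_iota/= add0n index_mem.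
    by rewrite nth_rcons index_mem xc nth_index.
  case: (x \in c) => /=; first by rewrite cats0.
  by rewrite nth_rcons ltnn eqxx cats1.
rewrite /species_counts -H /abundance -map_comp; apply: eq_map => l /=.
rewrite -[X in _ = count _ X](mkseq_nth 0%N c) /mkseq count_map.
by apply: eq_count => m /=; rewrite eq_sym.
Qed.

End species.

Section word_count.

Definition decrement (r : seq nat) (j : nat) : seq nat := set_nth 0%N r j (nth 0%N r j).-1.

(** The number of ways to build the vector [r] one individual at a time in [n] steps,
by the effect of the last individual: it joined the class [j], or it founded the
last class. *)
Fixpoint word_count (n : nat) (r : seq nat) : nat :=
  if n is n'.+1 then
    (\sum_(j < size r) (0 < nth 0 r j) * word_count n' (decrement r j)
     + (last 0 r == 1) * word_count n' (take (size r).-1 r))%N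
  else (r == [::]).

(** The given trajectory is itself one way to build its [n]-th vector. *)
Lemma word_count_gt0 (Pi : nat -> seq nat) (n : nat) : trajectory Pi -> (0 < n)%N ->
  (0 < word_count n (Pi n))%N.
Proof.
move=> [Pi1 PiS]; elim: n => // -[_ _|n ih _].
  by rewrite Pi1/= big_ord_recl big_ord0.
have := ih isT; have [//|->|[j js ->]] := PiS n.+1 => K0.
  rewrite [word_count _ _]/= last_rcons eqxx mul1n size_rcons/= -cats1 take_size_cat//.
  by rewrite addn_gt0 K0 orbT.
set r := Pi n.+1 in js K0 *; rewrite [word_count _ _]/=.
have js' : (j < size (incr_nth r j))%N by rewrite size_incr_nth js.
rewrite (bigD1 (Ordinal js'))//= nth_incr_nth eqxx/= mul1n.
suff -> : decrement (incr_nth r j) j = r by rewrite -addnA addn_gt0 K0.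
apply: (@eq_from_nth _ 0%N) => [|i].
  by rewrite size_set_nth size_incr_nth js; apply/maxn_idPr.
rewrite /decrement nth_set_nth/= !nth_incr_nth eqxx/=.
by move=> _; case: eqP => [->//|/eqP ij]; rewrite eq_sym (negbTE ij).
Qed.

End word_count.

Lemma decrementP (s r : seq nat) j : (j < size s)%N ->
  (incr_nth s j == r) = [&& (j < size r)%N, (0 < nth 0%N r j)%N & s == decrement r j].
Proof.
move=> js; apply/eqP/and3P => [<-|[jr r0 /eqP ->]].
  rewrite size_incr_nth js nth_incr_nth eqxx; split=> //; apply/eqP.
  apply: (@eq_from_nth _ 0%N) => [|i].
    by rewrite size_set_nth size_incr_nth js; symmetry; apply/maxn_idPr.
  rewrite /decrement nth_set_nth/= !nth_incr_nth eqxx/=.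
  by move=> _; case: eqP => [->//|/eqP ij]; rewrite eq_sym (negbTE ij).
apply: (@eq_from_nth _ 0%N) => [|i].
  rewrite size_incr_nth size_set_nth; have /maxn_idPr -> := jr.
  by rewrite jr.
move=> _; rewrite nth_incr_nth nth_set_nth/= [i == j]eq_sym.
by case: eqP => [<-|//]; rewrite add1n prednK.
Qed.

Section word_sum_abundance.
Variable R : realType.
Variable p : nat -> R.
Hypothesis p0 : forall x, 0 <= p x.
Local Open Scope ereal_scope.

Lemma monomial_rcons r a c x : size c = size r ->
  monomial p (rcons r a) (rcons c x) = (monomial p r c * p x ^+ a)%R.
Proof.
move=> cr; rewrite /monomial size_rcons big_ord_recr/=.
rewrite !nth_rcons cr !ltnn !eqxx; congr (_ * _)%R.
by apply: eq_bigr => j _; rewrite !nth_rcons cr !ltn_ord.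
Qed.

Lemma monomial_decrement r j c : (j < size r)%N -> (0 < nth 0%N r j)%N ->
  (monomial p (decrement r j) c * p (nth 0%N c j))%R = monomial p r c.
Proof.
move=> jr r0; rewrite /monomial size_set_nth; have /maxn_idPr -> := jr.
rewrite (bigD1 (Ordinal jr))//= [RHS](bigD1 (Ordinal jr))//=.
rewrite nth_set_nth/= eqxx mulrAC -exprSr prednK//; congr (_ * _)%R.
apply: eq_bigr => i; rewrite -val_eqE/= => ij.
by rewrite nth_set_nth/= (negbTE ij).
Qed.

(** The last letter of a word either repeats the [j]-th discovered species, and then
the counts before it were [decrement r j], or it is new, and then [r] ends with 1. *)
Lemma abundance_step r (G : seq nat -> \bar R) c : (forall c, 0 <= G c) ->
  let w (s : seq nat) := (\prod_(x <- c) p x * (species_counts c == s)%:R)%R in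
  let D := discovered c in
  \sum_(0 <= x <oo) (\prod_(y <- rcons c x) p y
      * (species_counts (rcons c x) == r)%:R)%:E * G (discovered (rcons c x)) =
  \sum_(j < size r) (0 < nth 0 r j)%N%:R%:E *
      ((w (decrement r j))%:E * ((p (nth 0%N D j))%:E * G D)) +
  (last 0%N r == 1%N)%:R%:E * ((w (take (size r).-1 r))%:E *
     \sum_(0 <= x <oo) (x \notin D)%:R%:E * ((p x)%:E * G (rcons D x))).
Proof.
move=> G0 w D.
have wt0 (s : seq nat) : (0 <= \prod_(x <- s) p x)%R by apply: prodr_ge0.
have w0 s : (0 <= w s)%R by rewrite mulr_ge0.
rewrite (nneseries_notin (discovered_uniq c)); last first.
  by move=> x; rewrite mule_ge0// lee_fin mulr_ge0.
have sD : size (species_counts c) = size D by rewrite size_map.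
congr (_ + _).
  have [Dr|Dr] := eqVneq (size D) (size r).
    rewrite (big_nth 0%N) -/D Dr big_mkord; apply: eq_bigr => j _.
    have jD : (j < size D)%N by rewrite Dr.
    have Djc : nth 0%N D j \in c by rewrite -mem_discovered mem_nth.
    rewrite discovered_rcons species_counts_rcons Djc index_uniq ?discovered_uniq//.
    rewrite decrementP ?sD// ltn_ord/= big_rcons/= /w !muleA -!EFinM.
    congr (_%:E * _).
    by case: (0 < _)%N; rewrite ?mul0r ?mulr0//= mul1r mulrAC.
  rewrite big_seq !big1// => [j _|x xD]; last first.
    rewrite mem_discovered in xD.
    rewrite species_counts_rcons xD; case: eqP => [rE|_]; last by rewrite mulr0 mul0e.
    case/eqP: Dr; rewrite -rE size_incr_nth sD index_mem mem_discovered xD//.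
  rewrite /w; case: eqP => [rE|_]; last by rewrite mulr0 mul0e mule0.
  case/eqP: Dr; rewrite -sD rE size_set_nth; exact/maxn_idPr.
rewrite muleA -EFinM -nneseriesZl; last by move=> x _; rewrite !mule_ge0// lee_fin.
apply: eq_eseriesr => x _; rewrite mem_discovered.
have [xc|xc] := boolP (x \in c); first by rewrite !mul0e mule0.
rewrite !mul1e species_counts_rcons discovered_rcons (negbTE xc) big_rcons/=.
rewrite muleA -EFinM; congr (_%:E * _); rewrite /w.
have -> : (rcons (species_counts c) 1%N == r) =
    (last 0%N r == 1%N) && (species_counts c == take (size r).-1 r).
  case: (lastP r) => [|r' a]; first by case: (species_counts c).
  rewrite eqseq_rcons last_rcons size_rcons/= -cats1 take_size_cat// andbC.
  by rewrite eq_sym.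
by case: eqP; case: eqP; rewrite ?(mul0r,mulr0,mul1r,mulr1)//= mulrC.
Qed.

(** Grouping the words with abundance vector [r] by the list [i] of their species in
order of discovery, each list occurs [word_count n r] times with weight
[monomial p r i].  The additional factor [G] makes the induction go through, since
the last letter changes that list. *)
Lemma word_sum_abundance n r (G : seq nat -> \bar R) : (forall c, 0 <= G c) ->
  word_sum n (fun c => (\prod_(x <- c) p x * (species_counts c == r)%:R)%:E
                       * G (discovered c)) =
  (word_count n r)%:R%:E *
  word_sum (size r) (fun i => ((uniq i)%:R * monomial p r i)%:E * G i).
Proof.
elim: n r G => [|n ih] r G G0.
  rewrite /= big_nil mul1r; case: r => [|a r] /=; last first.
    by rewrite !mul0e.
  by rewrite /monomial big_ord0 mulr1 !mul1e.
rewrite word_sum_rcons.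
pose G1 (j : 'I_(size r)) (i : seq nat) := (p (nth 0%N i j))%:E * G i.
pose G2 (i : seq nat) := \sum_(0 <= x <oo)
   (x \notin i)%:R%:E * ((p x)%:E * G (rcons i x)).
have G10 j i : 0 <= G1 j i by rewrite mule_ge0// lee_fin.
have G20 i : 0 <= G2 i.
  by apply: nneseries_ge0 => x _ _; rewrite !mule_ge0// lee_fin.
have wt0 (c : seq nat) : (0 <= \prod_(x <- c) p x)%R by apply: prodr_ge0.
rewrite [LHS](_ : _ = word_sum n (fun c =>
    \sum_(j < size r) (0 < nth 0 r j)%N%:R%:E *
      ((\prod_(x <- c) p x * (species_counts c == decrement r j)%:R)%:E * G1 j (discovered c))
  + (last 0%N r == 1%N)%:R%:E *
    ((\prod_(x <- c) p x * (species_counts c == take (size r).-1 r)%:R)%:E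
     * G2 (discovered c)))); last first.
  apply: eq_word_sum => c cn.
  exact: abundance_step.
rewrite word_sumD; last 2 first.
- by move=> c; apply: sume_ge0 => j _; rewrite !mule_ge0// ?lee_fin// mulr_ge0.
- by move=> c; rewrite !mule_ge0// ?lee_fin// mulr_ge0.
rewrite word_sum_sum; last by move=> j c; rewrite !mule_ge0// ?lee_fin// mulr_ge0.
rewrite word_sumZl; last by move=> c; rewrite !mule_ge0// ?lee_fin// mulr_ge0.
rewrite ih//.
under eq_bigr => j _.
  rewrite word_sumZl; last by move=> c; rewrite !mule_ge0// ?lee_fin// mulr_ge0.
  rewrite ih//.
  over.
rewrite /G2 [X in _ + X](_ : _ =
  ((last 0%N r == 1%N) * word_count n (take (size r).-1 r))%N%:R%:E *
  word_sum (size r) (fun i => ((uniq i)%:R * monomial p r i)%:E * G i)); last first.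
  case: (lastP r) => [|r' a]; first by rewrite /= !mul0e.
  rewrite last_rcons size_rcons -[(size r').+1.-1]/(size r').
  rewrite -[in take _ _]cats1 take_size_cat//.
  case: eqP => [->|_]; last by rewrite !mul0e.
  rewrite mul1n mul1e word_sum_rcons; congr (_ * _).
  apply: eq_word_sum => c cr.
  rewrite -nneseriesZl; last by move=> x _; rewrite !mule_ge0// lee_fin.
  apply: eq_eseriesr => x _.
  rewrite monomial_rcons// rcons_uniq expr1 !muleA -!EFinM; congr (_%:E * _).
  by case: (x \in c); case: (uniq c); rewrite /= ?(mul0r,mulr0,mul1r,mulr1).
rewrite -[X in _ = X * _]/((_ + _)%N%:R%:E) natrD EFinD ge0_muleDl ?lee_fin//.
congr (_ + _); rewrite natr_sum -sumEFin ge0_sume_distrl//.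
  apply: eq_bigr => j _; have [r0|r0] := boolP (0 < nth 0%N r j)%N; last first.
    by rewrite /= !mul0e.
  rewrite mul1n mul1e size_set_nth; have /maxn_idPr -> := ltn_ord j.
  congr (_ * _); apply: eq_word_sum => c cr.
  by rewrite /G1 muleA -EFinM -mulrA monomial_decrement.
Qed.
End word_sum_abundance.

(** * Densities and moments of Beta laws *)

Lemma image_measureP d1 d2 (T1 : measurableType d1) (T2 : measurableType d2)
    (R : realType) (mu : {measure set T1 -> \bar R}) (phi : T1 -> T2) :
  measurable_fun setT phi ->
  exists nu : {measure set T2 -> \bar R}, nu = pushforward mu phi :> (set T2 -> \bar R).
Proof.
move=> mphi.
unshelve refine (ex_intro _ (pushforward mu phi : {measure set _ -> \bar R}) erefl).
exact: mphi.
Qed.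

Section density.
Context d (T : measurableType d) (R : realType).
Variables (mu nu : {measure set T -> \bar R}) (g : T -> R).
Hypothesis mg : measurable_fun setT g.
Hypothesis g0 : forall x, 0 <= g x.
Hypothesis nuE : forall U, measurable U -> nu U = (\int[mu]_(x in U) (g x)%:E)%E.
Local Open Scope ereal_scope.

Import HBNNSimple.

Let ge0_integral_density_nnsfun (f : {nnsfun T >-> R}) :
  \int[nu]_x (f x)%:E = \int[mu]_x ((f x)%:E * (g x)%:E).
Proof.
under [LHS]eq_integral do rewrite fimfunE -fsumEFin//.
rewrite [LHS]ge0_integral_fsum//; last 2 first.
  - by move=> r; exact/measurable_EFinP/measurableT_comp.
  - by move=> n x _; rewrite EFinM nnfun_muleindic_ge0.
under [RHS]eq_integral.
  move=> x _; rewrite fimfunE -fsumEFin// ge0_mule_fsuml; last first.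
    by move=> r; rewrite EFinM nnfun_muleindic_ge0.
  over.
rewrite [RHS]ge0_integral_fsum//; last 2 first.
  - move=> r; apply: emeasurable_funM => //.
    by apply/measurable_EFinP; exact: measurableT_comp.
  - exact/measurable_EFinP.
  - move=> r x _; apply: mule_ge0; last by rewrite lee_fin.
    by rewrite EFinM nnfun_muleindic_ge0.
apply: eq_fsbigr => r _.
have mr : measurable (f @^-1` [set r]) by exact: measurable_sfunP.
under [RHS]eq_integral do rewrite EFinM -muleA.
have [r0|r0] := ltP r 0%R.
  rewrite (preimage_nnfun0 f r0) !integral0_eq// => x _; rewrite indicE in_set0 ?mulr0//.
  by rewrite mul0e mule0.
rewrite ge0_integralZl//; last 2 first.
- by apply: emeasurable_funM => //; apply/measurable_EFinP => //; exact: measurable_indic.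
- by move=> x _; rewrite mule_ge0// lee_fin.
under eq_integral do rewrite EFinM.
rewrite ge0_integralZl//; last exact/measurable_EFinP/measurable_indic.
congr (_ * _); rewrite integral_indic// setIT nuE// integral_mkcond.
apply: eq_integral => x _; rewrite patchE indicE; case: ifPn => xr.
  by rewrite mul1e.
by rewrite mul0e.
Qed.

(** The hypothesis is the case of indicators; simple functions follow by linearity and
the general case by monotone convergence. *)
Lemma ge0_integral_density (f : T -> \bar R) :
  measurable_fun setT f -> (forall x, 0 <= f x) ->
  \int[nu]_x f x = \int[mu]_x (f x * (g x)%:E).
Proof.
move=> mf f0; pose f_ := nnsfun_approx measurableT mf.
have fE x : f x = limn (fun n => (f_ n x)%:E).
  apply/esym/cvg_lim => //; exact: cvg_nnsfun_approx.
transitivity (limn (fun n => \int[nu]_x (f_ n x)%:E)).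
  rewrite -monotone_convergence//=.
  - by apply: eq_integral => x _.
  - by move=> n; exact/measurable_EFinP.
  - by move=> n x _; rewrite lee_fin.
  - by move=> x _ m n mn; rewrite lee_fin; exact/lefP/nd_nnsfun_approx.
under eq_fun do rewrite ge0_integral_density_nnsfun.
rewrite -monotone_convergence//=.
- apply: eq_integral => x _; apply/cvg_lim => //.
  by apply: cvgeZr => //; exact: cvg_nnsfun_approx.
- by move=> n; apply: emeasurable_funM => //; exact/measurable_EFinP.
- by move=> n x _; rewrite mule_ge0// lee_fin.
- move=> x _ m n mn; rewrite lee_wpmul2r ?lee_fin//.
  exact/lefP/nd_nnsfun_approx.
Qed.

End density.

Section beta_integral.
Variable R : realType.
Local Notation mu := (@lebesgue_measure R).

Definition beta_integral (u v : R) : \bar R :=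
  (\int[mu]_(x in `]0%R, 1%R[) (beta_kernel u v x)%:E)%E.

Lemma beta_kernel_ge0 (u v x : R) : 0 <= beta_kernel u v x.
Proof. by rewrite mulr_ge0 ?powR_ge0. Qed.

Lemma measurable_beta_kernel (u v : R) : measurable_fun setT (beta_kernel u v).
Proof.
apply: measurable_funM; first exact: measurable_powR.
apply: (measurableT_comp (@measurable_powR R (v - 1))).
by apply: measurable_funB; [exact: measurable_cst|exact: measurable_id].
Qed.

Lemma is_derive_powR_compl (v x : R) : x < 1 ->
  is_derive x 1 (fun x : R => - (1 - x) `^ v) (v * (1 - x) `^ (v - 1)).
Proof.
move=> x1.
have H : is_derive (1 - x) 1 (@powR R ^~ v) (v * (1 - x) `^ (v - 1)).
  by apply: is_derive1_powR; rewrite subr_gt0.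
have H2 : is_derive x 1 (fun x : R => 1 - x) (-1).
  have := @is_deriveB _ _ _ (cst 1 : R -> R) (@idfun R) x 1 _ _
    (is_derive_cst _ _ _) (is_derive_id _ _).
  by rewrite sub0r.
have H3 := @is_derive1_comp _ (@powR R ^~ v) (fun x : R => 1 - x) x _ _ H H2.
have := is_deriveN H3; rewrite mulrN1 opprK; exact.
Qed.

Lemma derivable_oo_LRcontinuousW (f : R -> R) (x y : R) : x <= y ->
  {in `[x, y], forall z, derivable f z 1} -> derivable_oo_LRcontinuous f x y.
Proof.
move=> xy df.
have cf z : z \in `[x, y] -> f t @[t --> z] --> f z.
  by move=> zxy; apply: differentiable_continuous; exact/derivable1_diffP/df.
split.
- by move=> z zxy; apply: df; exact: subset_itv_oo_cc zxy.
- by apply: cvg_at_right_filter; apply: cf; rewrite in_itv/= lexx.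
- by apply: cvg_at_left_filter; apply: cf; rewrite in_itv/= lexx xy.
Qed.

(** The offset makes [[shrunk n, 1 - shrunk n]] nonempty for every [n]. *)
Definition shrunk (n : nat) : R := n.+3%:R^-1.

Lemma shrunk_gt0 n : 0 < shrunk n.
Proof. by rewrite invr_gt0. Qed.

Lemma shrunk_lt n : shrunk n < 1 - shrunk n.
Proof.
rewrite ltrBrDr /shrunk -mulr2n -[_ *+ 2]mulr_natl ltr_pdivrMr// mul1r.
by rewrite ltr_nat.
Qed.

(** The Beta kernels can be singular at both ends, so one integrates by parts on
compact subintervals of [(0, 1)] first. *)
Lemma integral_shrunk_by_parts (u v : R) n : 0 < u -> 0 < v ->
  (v%:E * \int[mu]_(x in `[shrunk n, (1 - shrunk n)%R]) (beta_kernel (u + 1) v x)%:E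
  = (shrunk n `^ u * (1 - shrunk n) `^ v - (1 - shrunk n) `^ u * shrunk n `^ v)%:E
  + u%:E * \int[mu]_(x in `[shrunk n, (1 - shrunk n)%R]) (beta_kernel u (v + 1) x)%:E)%E.
Proof.
move=> u0 v0; set e := shrunk n.
have e0 : 0 < e := shrunk_gt0 n.
have e1 : e < 1 - e := shrunk_lt n.
have dF (x : R) : 0 < x -> is_derive x 1 (@powR R ^~ u) (u * x `^ (u - 1)).
  exact: is_derive1_powR.
have seg x : x \in `[e, 1 - e] -> 0 < x /\ x < 1.
  rewrite in_itv/= => /andP[ex xe]; split; first exact: lt_le_trans ex.
  by rewrite (le_lt_trans xe)// ltrBlDr ltrDl.
have seg' x : x \in `]e, 1 - e[ -> 0 < x /\ x < 1.
  by move=> xe; apply: seg; exact: subset_itv_oo_cc xe.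
have := @integration_by_parts R (@powR R ^~ u) (fun x : R => - (1 - x) `^ v)
   (fun x => u * x `^ (u - 1)) (fun x => v * (1 - x) `^ (v - 1)) e (1 - e) e1.
have -> : (\int[mu]_(x in `[e, (1 - e)%R]) (x `^ u * (v * (1 - x) `^ (v - 1)))%:E =
   v%:E * \int[mu]_(x in `[e, (1 - e)%R]) (beta_kernel (u + 1) v x)%:E)%E.
  rewrite -ge0_integralZl//.
  - by apply: eq_integral => x _; rewrite -EFinM /beta_kernel addrK mulrCA.
  - by apply/measurable_EFinP; apply: measurable_funTS; exact: measurable_beta_kernel.
  - by move=> x _; rewrite lee_fin beta_kernel_ge0.
  - by rewrite lee_fin ltW.
have -> : (\int[mu]_(x in `[e, (1 - e)%R]) (u * x `^ (u - 1) * - (1 - x) `^ v)%:E =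
   - (u%:E * \int[mu]_(x in `[e, (1 - e)%R]) (beta_kernel u (v + 1) x)%:E))%E.
  rewrite -ge0_integralZl//.
  - rewrite -integral_ge0N; last first.
      by move=> x _; rewrite mule_ge0// lee_fin ?beta_kernel_ge0// ltW.
    by apply: eq_integral => x _; rewrite -EFinM -EFinN /beta_kernel addrK mulrN mulrA.
  - by apply/measurable_EFinP; apply: measurable_funTS; exact: measurable_beta_kernel.
  - by move=> x _; rewrite lee_fin beta_kernel_ge0.
  - by rewrite lee_fin ltW.
rewrite oppeK subKr => -> //.
- by congr ((_)%:E + _)%E; rewrite !mulrN opprK addrC.
- apply: derivable_within_continuous => x /seg[x0 _]; apply: derivableM.
    exact: derivable_cst.
  by apply: derivable_powR; rewrite in_itv/= andbT.
- apply: derivable_oo_LRcontinuousW; first exact: ltW.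
  by move=> x /seg[x0 _]; apply: derivable_powR; rewrite in_itv/= andbT.
- by move=> x /seg'[x0 _]; rewrite powR_derive1// in_itv/= andbT.
- apply: derivable_within_continuous => x /seg[_ x1]; apply: derivableM.
    exact: derivable_cst.
  have := @ex_derive _ _ _ _ _ _ _ (is_derive_powR_compl (v - 1) x1).
  by move=> /derivableN; rewrite (_ : - _ = fun x => (1 - x) `^ (v - 1))//;
    apply/funext => y; exact: opprK.
- apply: derivable_oo_LRcontinuousW; first exact: ltW.
  by move=> x /seg[_ x1]; exact: (@ex_derive _ _ _ _ _ _ _ (is_derive_powR_compl v x1)).
- move=> x /seg'[_ x1]; rewrite derive1E.
  by have [_ ->] := is_derive_powR_compl v x1.
Qed.

Lemma bigcup_shrunk : \bigcup_n `[shrunk n, (1 - shrunk n)%R]%classic = `]0%R, 1%R[%classic :> set R.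
Proof.
apply/seteqP; split => [x [n _]|x]; rewrite /= !in_itv/=.
  move=> /andP[ex xe]; rewrite (lt_le_trans (shrunk_gt0 n) ex)/=.
  by rewrite (le_lt_trans xe)// ltrBlDr ltrDl shrunk_gt0.
move=> /andP[x0 x1].
pose m := Num.min x (1 - x); have m0 : 0 < m by rewrite lt_min x0 subr_gt0.
have sm : shrunk (Num.truncn m^-1) <= m.
  rewrite /shrunk -[leRHS]invrK lef_pV2 ?posrE ?invr_gt0//.
  by apply: ltW; apply: (lt_le_trans (truncnS_gt _)); rewrite ler_nat ltnS !leqW.
exists (Num.truncn m^-1) => //; rewrite /= in_itv/= (le_trans sm) ?ge_min ?lexx//=.
by rewrite lerBrDr -lerBrDl (le_trans sm)// ge_min lexx orbT.
Qed.

Lemma nondecreasing_shrunk :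
  nondecreasing_seq (fun n => `[shrunk n, (1 - shrunk n)%R]%classic : set R).
Proof.
move=> m n mn; apply/subsetPset => x; rewrite /= !in_itv/= => /andP[mx xm].
have nm : shrunk n <= shrunk m by rewrite lef_pV2 ?posrE// ler_nat.
by rewrite (le_trans nm)//= (le_trans xm)// lerD2l lerN2.
Qed.

Lemma shrunk_boundary (u v : R) : 0 < u -> 0 < v ->
  (shrunk n `^ u * (1 - shrunk n) `^ v @[n --> \oo] --> 0)%R.
Proof.
move=> u0 v0.
have s0 : shrunk n @[n --> \oo] --> (0:R).
  have := @cvg_harmonic R; rewrite -(cvg_shiftn 2); apply: cvg_trans.
  by apply: near_eq_cvg; near=> n; rewrite /= /shrunk addn2.
have s1 : shrunk n `^ u @[n --> \oo] --> 0.
  have /cvg_at_rightP := powR_cvg0 u0; apply; split => // n; exact: shrunk_gt0.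
apply: (@squeeze_cvgr _ _ _ _ (cst 0) (fun n => shrunk n `^ u)) => //; last exact: cvg_cst.
near=> n; rewrite mulr_ge0 ?powR_ge0//= ler_piMr ?powR_ge0//.
rewrite [leRHS](_ : 1 = 1 `^ v); last by rewrite powR1.
have e0 := shrunk_gt0 n; have e1 := shrunk_lt n.
apply: ge0_ler_powR; rewrite ?nnegrE; [exact: ltW| |exact: ler01|].
  exact: (ltW (lt_trans e0 e1)).
by rewrite lerBlDr lerDl ltW.
Unshelve. all: by end_near. Qed.

(** The boundary terms on the compact subintervals tend to zero, and the integrals
converge monotonically. *)
Lemma beta_integral_by_parts (u v : R) : 0 < u -> 0 < v ->
  (v%:E * beta_integral (u + 1) v = u%:E * beta_integral u (v + 1))%E.
Proof.
move=> u0 v0.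
have cvgI (s t : R) : (\int[mu]_(x in `[shrunk n, (1 - shrunk n)%R]) (beta_kernel s t x)%:E
    @[n --> \oo] --> beta_integral s t)%E.
  rewrite /beta_integral -bigcup_shrunk; apply: ge0_nondecreasing_set_cvg_integral => //.
  - exact: nondecreasing_shrunk.
  - by move=> n; apply/measurable_EFinP; apply: measurable_funTS; exact: measurable_beta_kernel.
  - by move=> n x _; rewrite lee_fin beta_kernel_ge0.
have L := cvgeZl (y := v%:E) isT (cvgI (u + 1) v).
have L' := cvgeZl (y := u%:E) isT (cvgI u (v + 1)).
have B : ((shrunk n `^ u * (1 - shrunk n) `^ v - (1 - shrunk n) `^ u * shrunk n `^ v)%:E
    @[n --> \oo] --> (0 : \bar R))%E.
  apply: cvg_EFin; first exact: nearW.
  have := cvgB (shrunk_boundary u0 v0) (shrunk_boundary v0 u0); rewrite subr0.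
  move=> H; refine (cvg_trans _ (H _)); apply: near_eq_cvg; apply: nearW => n.
  by congr (_ - _); exact: mulrC.
have : (v%:E * \int[mu]_(x in `[shrunk n, (1 - shrunk n)%R]) (beta_kernel (u + 1) v x)%:E
    @[n --> \oo] --> 0 + u%:E * beta_integral u (v + 1))%E.
  under eq_cvg do rewrite integral_shrunk_by_parts//.
  by apply: cvgeD => //; rewrite fin_num_adde_defr.
by rewrite add0e => /(cvg_unique _ L); apply.
Qed.

End beta_integral.

Section rising.
Variable R : realType.

Definition rising (x : R) (n : nat) : R := \prod_(i < n) (x + i%:R).

Lemma rising0 x : rising x 0 = 1.
Proof. by rewrite /rising big_ord0. Qed.

Lemma risingS x n : rising x n.+1 = rising x n * (x + n%:R).
Proof. by rewrite /rising big_ord_recr. Qed.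

Lemma risingSl x n : rising x n.+1 = x * rising (x + 1) n.
Proof.
rewrite /rising big_ord_recl/= addr0; congr (_ * _); apply: eq_bigr => i _.
by rewrite -addrA -natr1 [X in x + X]addrC.
Qed.

Lemma rising_gt0 x n : 0 < x -> 0 < rising x n.
Proof. by move=> x0; apply: prodr_gt0 => i _; rewrite ltr_wpDr. Qed.

Lemma rising_ge0 x n : 0 <= x -> 0 <= rising x n.
Proof. by move=> x0; apply: prodr_ge0 => i _; rewrite addr_ge0. Qed.

End rising.

Section beta_moments.
Variable R : realType.
Local Notation mu := (@lebesgue_measure R).

Lemma beta_integral_ge0 (u v : R) : (0 <= beta_integral u v)%E.
Proof. by apply: integral_ge0 => x _; rewrite lee_fin beta_kernel_ge0. Qed.

(** [1 = x + (1 - x)] under the integral. *)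
Lemma beta_integral_split (u v : R) : 0 < u -> 0 < v ->
  beta_integral u v = (beta_integral (u + 1) v + beta_integral u (v + 1))%E.
Proof.
move=> u0 v0.
have mk (s t : R) : measurable_fun (`]0%R, 1%R[%classic : set R) (fun x => (beta_kernel s t x)%:E).
  apply/measurable_EFinP; apply: measurable_funTS.
  exact: measurable_beta_kernel.
rewrite /beta_integral -ge0_integralD//; first last.
- exact: mk.
- by move=> x _; rewrite lee_fin beta_kernel_ge0.
- exact: mk.
- by move=> x _; rewrite lee_fin beta_kernel_ge0.
apply: eq_integral => x; rewrite inE/= in_itv/= => /andP[x0 x1].
rewrite -EFinD; congr (_%:E); rewrite /beta_kernel !addrK.
rewrite -(mulr_powRB1 (ltW x0) u0) -(@mulr_powRB1 _ (1 - x) v) ?subr_ge0 ?ltW//.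
by ring.
Qed.

(** The sum of the two unknowns and the ratio given by integration by parts form a
linear system. *)
Lemma beta_integral_step (u v k : R) : 0 < u -> 0 < v ->
  beta_integral u v = k%:E ->
  beta_integral (u + 1) v = (u / (u + v) * k)%:E /\
  beta_integral u (v + 1) = (v / (u + v) * k)%:E.
Proof.
move=> u0 v0; rewrite beta_integral_split// => xy.
have := beta_integral_by_parts u0 v0; move: xy.
have := beta_integral_ge0 u (v + 1); have := beta_integral_ge0 (u + 1) v.
case: (beta_integral (u + 1) v) => [x||]//; last by case: (beta_integral u (v + 1)).
case: (beta_integral u (v + 1)) => [y||]// x0 y0.
rewrite -EFinD -!EFinM => -[xy] [E].
have uv : u + v != 0 by rewrite gt_eqF// addr_gt0.
split; congr (_%:E); rewrite mulrAC; apply: (mulIf uv); rewrite mulfVK//.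
  by rewrite mulrDr -xy mulrDr (mulrC x v) E; ring.
by rewrite mulrDr -xy mulrDr (mulrC y u) -E; ring.
Qed.

Variables (a b : R) (nu : probability R R).
Hypotheses (a0 : 0 < a) (b0 : 0 < b).
Hypothesis nuE : forall U, measurable U -> nu U = real_beta_law a b U.

Lemma real_beta_fun_ge0 : 0 <= real_beta_fun a b.
Proof. by apply: Rintegral_ge0 => x _; exact: beta_kernel_ge0. Qed.

Lemma beta_law_scale : ((real_beta_fun a b)^-1%:E * beta_integral a b = 1)%E.
Proof.
have := nuE measurableT; rewrite probability_setT /real_beta_law setTI => ->.
rewrite -ge0_integralZl//.
- by apply: eq_integral => x _; rewrite -EFinM mulrC.
- by apply/measurable_EFinP; apply: measurable_funTS; exact: measurable_beta_kernel.
- by move=> x _; rewrite lee_fin beta_kernel_ge0.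
- by rewrite lee_fin invr_ge0 real_beta_fun_ge0.
Qed.

(** The normalizing constant is defined as the real part of an integral, which
would be 0 if the integral were infinite; but a law has total mass one. *)
Lemma beta_integralE : beta_integral a b = (real_beta_fun a b)%:E.
Proof.
have := beta_law_scale; rewrite /real_beta_fun /Rintegral -/(beta_integral a b).
have := beta_integral_ge0 a b; case: (beta_integral a b) => //=.
by rewrite invr0 mul0e => _ /eqP; rewrite eq_sym onee_eq0.
Qed.

Lemma real_beta_fun_neq0 : real_beta_fun a b != 0.
Proof.
have := beta_law_scale; rewrite beta_integralE.
by apply: contra_eqN => /eqP ->; rewrite mule0 eq_sym onee_eq0.
Qed.

Lemma beta_integral_rising i j : beta_integral (a + i%:R) (b + j%:R) =
  (rising a i * rising b j / rising (a + b) (i + j) * real_beta_fun a b)%:E.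
Proof.
have ab0 : 0 < a + b by rewrite addr_gt0.
elim: j => [|j ihj].
  elim: i => [|i ihi].
    by rewrite !addr0 beta_integralE !rising0 !mul1r invr1 mul1r.
  rewrite addr0 in ihi *.
  have ai : 0 < a + i%:R by rewrite ltr_wpDr.
  have [+ _] := beta_integral_step ai b0 ihi.
  rewrite -natr1 addrA => ->; congr (_%:E); rewrite !addn0 !risingS.
  have abi : a + b + i%:R != 0 by rewrite gt_eqF// ltr_wpDr.
  have rn : rising (a + b) i != 0 by rewrite gt_eqF// rising_gt0.
  by rewrite (_ : a + i%:R + b = a + b + i%:R); [field; rewrite abi|ring].
have bj : 0 < b + j%:R by rewrite ltr_wpDr.
have ai : 0 < a + i%:R by rewrite ltr_wpDr.
have [_] := beta_integral_step ai bj ihj.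
rewrite -[j.+1%:R]natr1 [b + (_ + 1)]addrA => ->; congr (_%:E); rewrite addnS !risingS.
have abi : a + b + (i + j)%:R != 0 by rewrite gt_eqF// ltr_wpDr.
have rn : rising (a + b) (i + j) != 0 by rewrite gt_eqF// rising_gt0.
rewrite natrD in abi rn *.
rewrite (_ : a + i%:R + (b + j%:R) = a + b + (i%:R + j%:R)); last by ring.
by field; rewrite abi.
Qed.

Lemma beta_moment i j : (\int[nu]_x (slot (i, j) x)%:E =
  (rising a i * rising b j / rising (a + b) (i + j))%:E)%E.
Proof.
pose g x : R := if x \in `]0, 1[ then beta_kernel a b x / real_beta_fun a b else 0.
have g0 x : 0 <= g x.
  rewrite /g; case: ifP => // _.
  by rewrite divr_ge0 ?beta_kernel_ge0 ?real_beta_fun_ge0.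
have gE : g = (fun x => beta_kernel a b x / real_beta_fun a b) \_ `]0, 1[.
  by apply/funext => x; rewrite patchE mem_setE.
have mg : measurable_fun setT g.
  rewrite gE.
  apply/(measurable_restrictT _ _).1 => //; apply: measurable_funTS.
  by apply: measurable_funM => //; exact: measurable_beta_kernel.
(* The identity transports the law to the copy of the real line on which Lebesgue
   measure is defined. *)
pose phi : R -> measurableTypeR R := idfun.
have mphi : measurable_fun setT phi by move=> _ U mU; rewrite setTI; exact: mU.
have [nu' nu'E] := image_measureP nu mphi.
transitivity (\int[nu']_x (slot (i, j) x)%:E)%E.
  rewrite nu'E ge0_integral_pushforward//.
    by apply/measurable_EFinP; exact: measurable_slot.
  by move=> x _; rewrite lee_fin slot_ge0.
rewrite (@ge0_integral_density _ _ R mu nu' g)//; last 3 first.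
- move=> U mU; rewrite nu'E /pushforward/= nuE// /real_beta_law integral_mkcondr.
  by apply: eq_integral => x _; rewrite gE !patchE; case: ifPn.
- by apply/measurable_EFinP; exact: measurable_slot.
- by move=> x; rewrite lee_fin slot_ge0.
transitivity (((real_beta_fun a b)^-1)%:E * beta_integral (a + i%:R) (b + j%:R))%E.
  rewrite -ge0_integralZl//; last 3 first.
  - by apply/measurable_EFinP; apply: measurable_funTS; exact: measurable_beta_kernel.
  - by move=> x _; rewrite lee_fin beta_kernel_ge0.
  - by rewrite lee_fin invr_ge0 real_beta_fun_ge0.
  rewrite [RHS]integral_mkcond; apply: eq_integral => x _.
  rewrite gE !patchE; case: ifPn => [|_]; last by rewrite mule0.
  rewrite inE/= in_itv/= => /andP[x0 x1]; rewrite -!EFinM; congr (_%:E).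
  rewrite /slot/= ger0_norm ?(ltW x0)// ger0_norm ?subr_ge0 ?(ltW x1)//.
  have y0 : 0 < 1 - x by rewrite subr_gt0.
  rewrite /beta_kernel [a + i%:R - 1]addrAC [b + j%:R - 1]addrAC.
  rewrite (@powRD _ x (a - 1)) ?(gt_eqF x0) ?implybT//.
  rewrite (@powRD _ (1 - x) (b - 1)) ?(gt_eqF y0) ?implybT//.
  by rewrite !powR_mulrn ?ltW//; ring.
rewrite beta_integral_rising -EFinM; congr (_%:E).
by rewrite mulrC mulfK// real_beta_fun_neq0.
Qed.

End beta_moments.

(** * Integration of independent variables *)

Section restricted_integral.
Context d (T : measurableType d) (R : realType) (mu : {measure set T -> \bar R}).
Variables (E : set T) (mE : measurable E).
Local Open Scope ereal_scope.

Lemma ge0_integral_mrestr (f : T -> \bar R) :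
  measurable_fun setT f -> (forall x, 0 <= f x) ->
  \int[mrestr mu mE]_x f x = \int[mu]_(x in E) f x.
Proof.
move=> mf f0; rewrite (@ge0_integral_density _ _ _ mu _ (\1_E : T -> R))//.
- rewrite [RHS]integral_mkcond; apply: eq_integral => x _.
  by rewrite patchE indicE; case: ifPn => _; rewrite ?mule1 ?mule0.
- by move=> U mU; rewrite integral_indic// setIC.
Qed.

End restricted_integral.

Section independent_pair.
Context d (T : measurableType d) (R : realType) (Q : probability T R).
Context d1 (T1 : measurableType d1) d2 (T2 : measurableType d2).
Variables (Y1 : T -> T1) (Y2 : T -> T2).
Hypotheses (mY1 : measurable_fun setT Y1) (mY2 : measurable_fun setT Y2).
Variables (E : set T) (mE : measurable E) (nu : probability T2 R).
Hypothesis indep : forall A B, measurable A -> measurable B ->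
  (Q (Y1 @^-1` A `&` Y2 @^-1` B `&` E) = Q (Y1 @^-1` A `&` E) * nu B)%E.
Local Open Scope ereal_scope.

Definition law_on (A : set T1) : \bar R := Q (Y1 @^-1` A `&` E).

Let law_on0 : law_on set0 = 0.
Proof. by rewrite /law_on preimage_set0 set0I measure0. Qed.

Let law_on_ge0 A : 0 <= law_on A.
Proof. exact: measure_ge0. Qed.

Let law_on_sigma_additive : semi_sigma_additive law_on.
Proof.
have [nu' nu'E] := image_measureP (mrestr Q mE) mY1.
by rewrite (_ : law_on = nu') ?nu'E//; exact: measure_semi_sigma_additive.
Qed.

HB.instance Definition _ := isMeasure.Build _ _ _ law_on
  law_on0 law_on_ge0 law_on_sigma_additive.

Let law_on_finite : fin_num_fun law_on.
Proof.
move=> A mA; apply: fin_num_measure; apply: measurableI => //.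
by rewrite -[X in measurable X]setTI; exact: mY1.
Qed.

HB.instance Definition _ := @Measure_isFinite.Build _ _ _ law_on law_on_finite.

Lemma ge0_integral_law_on (f : T1 -> \bar R) : measurable_fun setT f ->
  (forall x, 0 <= f x) -> \int[law_on]_x f x = \int[Q]_(t in E) f (Y1 t).
Proof.
move=> mf f0; have [nu' nu'E] := image_measureP (mrestr Q mE) mY1.
transitivity (\int[nu']_x f x).
  by apply: eq_measure_integral => A mA _; rewrite nu'E.
rewrite nu'E ge0_integral_pushforward//= ge0_integral_mrestr//.
exact: measurableT_comp mf mY1.
Qed.

(** By the hypothesis, the law of the pair restricted to [E] coincides with the
product of [law_on] and [nu] on rectangles, hence everywhere, and Fubini's theorem
applies.  The event [E] makes it possible to integrate out one variable of a
sequence while the others remain constrained. *)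
Lemma ge0_integral_independent_pair (h : T1 * T2 -> \bar R) :
  measurable_fun setT h -> (forall z, 0 <= h z) ->
  \int[Q]_(t in E) h (Y1 t, Y2 t) = \int[Q]_(t in E) \int[nu]_y h (Y1 t, y).
Proof.
move=> mh h0.
have mY : measurable_fun setT (fun t => (Y1 t, Y2 t)) by exact: measurable_fun_pair.
rewrite -(@ge0_integral_law_on (fun x => \int[nu]_y h (x, y))); last 2 first.
- exact: (measurable_fun_fubini_tonelli_F (m2 := nu) h mh h0).
- by move=> x; apply: integral_ge0 => y _; exact: h0.
rewrite -(fubini_tonelli1 (m1 := law_on) (m2 := nu) h mh h0).
have [nu' nu'E] := image_measureP (mrestr Q mE) mY.
transitivity (\int[nu']_z h z).
  rewrite nu'E ge0_integral_pushforward//= ge0_integral_mrestr//.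
  exact: measurableT_comp mh mY.
apply: eq_measure_integral => A mA _; symmetry.
apply: product_measure_unique => // B C mB mC.
by rewrite nu'E /pushforward/= /mrestr -indep.
Qed.

End independent_pair.

Section tail_independence.
Context d (T : measurableType d) (R : realType) (Q : probability T R).
Variable W : nat -> {RV Q >-> R}.
Hypothesis indepW : mutually_independent W.

(** A pi-system generating the sigma-algebra of the variables with index above [N]. *)
Definition tail_cylinders (N : nat) : set (set T) :=
  [set C | exists (J : {fset nat}) (A : nat -> set R),
    [/\ forall j, j \in J -> (N < j)%N, forall j, measurable (A j) &
        C = \bigcap_(j in [set` J]) (W j @^-1` A j)]].

Lemma measurable_RV_preimage j (A : set R) : measurable A -> measurable (W j @^-1` A).
Proof. by move=> mA; rewrite -[X in measurable X]setTI; exact: measurable_funP. Qed.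

Lemma tail_cylinders_measurable N : tail_cylinders N `<=` measurable.
Proof.
move=> _ [J [A [_ mA ->]]]; apply: bigcap_measurableType => j _.
exact: measurable_RV_preimage.
Qed.

Lemma tail_cylindersT N : tail_cylinders N setT.
Proof.
exists fset0, (fun=> setT); split => //.
by apply/seteqP; split => // t _ j.
Qed.

Lemma tail_cylindersI N : setI_closed (tail_cylinders N).
Proof.
move=> _ _ [J [A [JN mA ->]]] [K [B [KN mB ->]]].
exists (J `|` K)%fset, (fun j => (if j \in J then A j else setT) `&`
                               (if j \in K then B j else setT)); split.
- by move=> j; rewrite inE => /orP[/JN|/KN].
- by move=> j; apply: measurableI; case: ifP.
apply/seteqP; split => [t [tA tB] j jJK|t tAB].
  by split; case: ifP => // jX; [exact: tA|exact: tB].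
split => j jX; have := tAB j.
  by rewrite /= inE (_ : j \in J = true)// => /(_ isT)[].
by rewrite /= inE (_ : j \in K = true)// orbT => /(_ isT)[].
Qed.

(** For fixed [B] both sides are finite measures in [A] that agree on the pi-system of
cylinders. *)
Lemma tail_independent N A (B : set R) : <<s tail_cylinders N >> A -> measurable B ->
  Q (A `&` W N @^-1` B) = (Q A * distribution Q (W N) B)%E.
Proof.
move=> sA mB; have mWB := measurable_RV_preimage N mB.
rewrite muleC.
have p0 : (0 <= fine (distribution Q (W N) B)) by exact: fine_ge0.
pose p := NngNum p0.
have pE : (p%:num)%:E = distribution Q (W N) B by rewrite fineK// fin_num_measure.
have scaleE C : mscale p Q C = (distribution Q (W N) B * Q C)%E.
  by rewrite -pE.
rewrite -scaleE.
transitivity (mrestr Q mWB A); first by [].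
apply: (@g_sigma_algebra_measure_unique _ R _ (tail_cylinders N)
   (@tail_cylinders_measurable N) (fun=> setT)) => //.
- by move=> _; exact: tail_cylindersT.
- by apply/seteqP; split => // t _; exists 0%N.
- exact: tail_cylindersI.
- move=> _ [J [C [JN mC ->]]]; rewrite [RHS]scaleE /mrestr /distribution /pushforward.
  have NJ : N \notin J by apply/negP => /JN; rewrite ltnn.
  pose C' j := if j == N then B else C j.
  have mC' j : measurable (C' j) by rewrite /C'; case: eqP.
  have C'N : C' N = B by rewrite /C' eqxx.
  have C'J j : j \in J -> C' j = C j.
    by move=> jJ; rewrite /C'; case: eqP => // jN; rewrite jN (negbTE NJ) in jJ.
  have := indepW (N |` J)%fset mC'.
  rewrite big_fsetU1//= C'N.
  have -> : \bigcap_(j in [set` (N |` J)%fset]) (W j @^-1` C' j) =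
      \bigcap_(j in [set` J]) (W j @^-1` C j) `&` W N @^-1` B.
    apply/seteqP; split => [t tC|t [tC tB] j].
      split; first move=> j /= jJ.
        by have := tC j; rewrite /= inE jJ orbT C'J//; exact.
      by have := tC N; rewrite /= !inE eqxx C'N; exact.
    by rewrite /= !inE => /orP[/eqP ->|jJ]; rewrite ?C'N// C'J//; exact: tC.
  move=> H; apply: (etrans H); congr (_ * _)%E; apply: (etrans _ (esym (indepW _ mC))).
  by apply: eq_big_seq => j jJ; rewrite C'J.
- by move=> _; rewrite ltey_eq fin_num_measure//; exact: measurableI.
Qed.

Definition tail_type N := g_sigma_algebraType (tail_cylinders N).

Lemma measurable_tail N j : (N < j)%N ->
  measurable_fun setT (W j : tail_type N -> R).
Proof.
move=> Nj _ A mA; rewrite setTI; apply: sub_gen_smallest.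
exists [fset j]%fset, (fun=> A); split => //.
  by move=> k; rewrite inE => /eqP ->.
apply/seteqP; split => [t tA k|t]; first by rewrite /= inE => /eqP ->.
by apply; rewrite /= inE.
Qed.

Lemma measurable_id_tail N : measurable_fun setT (id : T -> tail_type N).
Proof.
move=> _ A mA; rewrite setTI.
exact: (smallest_sub (@sigma_algebra_measurable _ T) (@tail_cylinders_measurable N) mA).
Qed.

(** Measurability of [g] for the tail sigma-algebra says that [g] depends only on the
variables after the [N]-th one. *)
Lemma integral_tail_mul N (f : R -> R) (g : T -> \bar R) :
  measurable_fun setT f -> (forall x, 0 <= f x) ->
  measurable_fun setT (g : tail_type N -> \bar R) -> (forall t, 0 <= g t)%E ->
  (\int[Q]_t ((f (W N t))%:E * g t) = \int[Q]_t (f (W N t))%:E * \int[Q]_t g t)%E.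
Proof.
move=> mf f0 mg g0.
pose h (z : tail_type N * R) := ((f z.2)%:E * g z.1)%E.
have mh : measurable_fun setT h.
  apply: emeasurable_funM.
    by apply/measurable_EFinP; apply: measurableT_comp mf _; exact: measurable_snd.
  by apply: measurableT_comp mg _; exact: measurable_fst.
have h0 z : (0 <= h z)%E by rewrite mule_ge0// lee_fin.
have mgT : measurable_fun setT g.
  exact: (measurableT_comp mg (@measurable_id_tail N)).
have I0 : (0 <= \int[distribution Q (W N)]_y (f y)%:E)%E.
  by apply: integral_ge0 => y _; rewrite lee_fin.
have := @ge0_integral_independent_pair _ T R Q _ (tail_type N) _ R
  id (W N) (@measurable_id_tail N) (measurable_funP _) setT measurableT
  (distribution Q (W N)) _ h mh h0.
rewrite /h/= => ->; last first.
  by move=> A B mA mB; rewrite !setIT tail_independent.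
transitivity (\int[Q]_t (\int[distribution Q (W N)]_y (f y)%:E * g t))%E.
  apply: eq_integral => t _.
  under eq_integral do rewrite muleC.
  rewrite ge0_integralZl// 1?muleC//; first exact/measurable_EFinP.
  by move=> y _; rewrite lee_fin.
rewrite ge0_integralZl//; congr (_ * _)%E.
rewrite ge0_integral_distribution//; exact/measurable_EFinP.
Qed.

End tail_independence.

(** * The exchangeable partition probability function *)

Section remove.

Lemma prod_remove (K : comRingType) (f : nat -> K) (rs : seq nat) j : (j < size rs)%N ->
  \prod_(r <- rs) f r = f (nth 0%N rs j) * \prod_(r <- remove rs j) f r.
Proof.
move=> js; rewrite -{1}(cat_take_drop j rs) (drop_nth 0%N js) /remove.
by rewrite !big_cat/= big_cons mulrCA.
Qed.

Lemma sumn_remove (rs : seq nat) j : (j < size rs)%N ->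
  sumn rs = (nth 0%N rs j + sumn (remove rs j))%N.
Proof.
move=> js; rewrite -{1}(cat_take_drop j rs) (drop_nth 0%N js) /remove.
by rewrite !sumn_cat/= addnCA.
Qed.

Lemma size_remove (T : Type) (rs : seq T) j : (j < size rs)%N ->
  size (remove rs j) = (size rs).-1.
Proof.
by move=> js; rewrite /remove size_cat size_take js size_drop; lia.
Qed.

Lemma all_remove (rs : seq nat) P j : all P rs -> all P (remove rs j).
Proof.
move=> /allP aP; apply/allP => r; rewrite mem_cat => /orP[/mem_take|/mem_drop];
  exact: aP.
Qed.

Lemma remove_powers (rs : seq nat) j : remove (powers rs) j = powers (remove rs j).
Proof. by rewrite /remove /powers map_cat map_take map_drop. Qed.

Lemma sumn_gt0 (rs : seq nat) : all (ltn 0%N) rs -> (0 < size rs)%N -> (0 < sumn rs)%N.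
Proof. by case: rs => //= r rs /andP[r0 _] _; rewrite addn_gt0 r0. Qed.

End remove.

Section eppf.
Variable R : realType.
Implicit Types (theta alpha : R) (rs : seq nat).

(** The rising factorial with increment [s]. *)
Definition steps (x s : R) (n : nat) : R := \prod_(i < n) (x + i%:R * s).

Lemma steps0 x s : steps x s 0 = 1.
Proof. by rewrite /steps big_ord0. Qed.

Lemma stepsS x s n : steps x s n.+1 = steps x s n * (x + n%:R * s).
Proof. by rewrite /steps big_ord_recr. Qed.

Lemma stepsSl x s n : steps x s n.+1 = x * steps (x + s) s n.
Proof.
rewrite /steps big_ord_recl/= mul0r addr0; congr (_ * _); apply: eq_bigr => i _.
by rewrite -addrA -natr1 mulrDl mul1r [X in x + X]addrC.
Qed.

Lemma steps_gt0 x s n : 0 < x -> 0 <= s -> 0 < steps x s n.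
Proof. by move=> x0 s0; apply: prodr_gt0 => i _; rewrite ltr_wpDr// mulr_ge0. Qed.

(** Pitman's probability that a sample from PDP(alpha, theta) is partitioned into given
classes of sizes [rs]. *)
Definition eppf theta alpha rs : R :=
  steps (theta + alpha) alpha (size rs).-1 / rising (theta + 1) (sumn rs).-1
  * \prod_(r <- rs) rising (1 - alpha) r.-1.

(** The moment [E(W^i (1 - W)^j)] of a Beta(1 - alpha, theta + alpha) variable. *)
Definition beta_ratio theta alpha i j : R :=
  rising (1 - alpha) i * rising (theta + alpha) j / rising (theta + 1) (i + j).

(** In [eppf] the common first factor [theta] of numerator and denominator is
cancelled, because it may be nonpositive; when it is positive, restoring it
gives complete products. *)
Lemma eppf_pos theta alpha rs : 0 < theta -> all (ltn 0%N) rs ->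
  eppf theta alpha rs = steps theta alpha (size rs) / rising theta (sumn rs)
  * \prod_(r <- rs) rising (1 - alpha) r.-1.
Proof.
move=> t0; rewrite /eppf; case: rs => [|r rs].
  by move=> _; rewrite !steps0 !rising0.
move=> rs0; have := sumn_gt0 rs0 isT; case: (sumn _) => // n _.
rewrite [size _]/= stepsSl risingSl/=; congr (_ * _).
have t0' : theta != 0 by rewrite gt_eqF.
have r0 : rising (theta + 1) n != 0 by rewrite gt_eqF// rising_gt0// ltr_wpDr.
by field; rewrite ?r0 ?r1.
Qed.

(** This mirrors the first stick, of length [W]: it carries either none of the classes
or exactly one class [j], and the rest of the unit interval, of length [1 - W], is
broken with the parameter [theta + alpha]. *)
Lemma eppf_rec theta alpha rs : 0 <= alpha < 1 -> - alpha < theta ->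
  all (ltn 0%N) rs -> (0 < size rs)%N ->
  eppf theta alpha rs =
  beta_ratio theta alpha 0 (sumn rs) * eppf (theta + alpha) alpha rs +
  \sum_(j < size rs) beta_ratio theta alpha (nth 0%N rs j) (sumn rs - nth 0%N rs j)
     * eppf (theta + alpha) alpha (remove rs j).
Proof.
move=> /andP[a0 a1] ta rs0 k0; set t := theta + alpha.
have t0 : 0 < t by rewrite -ltrBlDr sub0r.
have t1 : 0 < theta + 1 by rewrite -ltrBlDr sub0r (lt_trans _ ta)// ltrN2.
have n0 := sumn_gt0 rs0 k0.
have E0 : beta_ratio theta alpha 0 (sumn rs) * eppf t alpha rs =
    steps t alpha (size rs) / rising (theta + 1) (sumn rs)
    * \prod_(r <- rs) rising (1 - alpha) r.-1.
  rewrite eppf_pos// /beta_ratio rising0 mul1r add0n -/t.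
  have r0 : rising t (sumn rs) != 0 by rewrite gt_eqF// rising_gt0.
  have r1 : rising (theta + 1) (sumn rs) != 0 by rewrite gt_eqF// rising_gt0.
  by field; rewrite ?r0 ?r1.
have Ej (j : 'I_(size rs)) : beta_ratio theta alpha (nth 0%N rs j) (sumn rs - nth 0%N rs j)
     * eppf t alpha (remove rs j) =
    steps t alpha (size rs).-1 / rising (theta + 1) (sumn rs) *
    \prod_(r <- rs) rising (1 - alpha) r.-1 * ((nth 0%N rs j)%:R - alpha).
  rewrite eppf_pos ?all_remove// size_remove// /beta_ratio -/t.
  rewrite (sumn_remove (ltn_ord j)) addKn (prod_remove _ (ltn_ord j)).
  have /(all_nthP 0%N)/(_ j (ltn_ord j)) := rs0; case: (nth 0%N rs j) => // r _.
  rewrite risingS/=.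
  set s := sumn _.
  have r0 : rising t s != 0 by rewrite gt_eqF// rising_gt0.
  have r1 : rising (theta + 1) (r.+1 + s) != 0 by rewrite gt_eqF// rising_gt0.
  by rewrite -natr1; field; rewrite ?r0 ?r1.
rewrite E0 (eq_bigr _ (fun j _ => Ej j)) -mulr_sumr sumrB sumr_const card_ord.
have -> : \sum_(i < size rs) (nth 0%N rs i)%:R = (sumn rs)%:R :> R.
  by rewrite sumnE (big_nth 0%N) big_mkord natr_sum.
rewrite /eppf -/t; case: (size rs) k0 => // k _; case: (sumn rs) n0 => // n _.
rewrite stepsS risingS [_.+1.-1]/= [_.+1.-1]/=.
have r1 : rising (theta + 1) n != 0 by rewrite gt_eqF// rising_gt0.
have r2 : theta + 1 + n%:R != 0 by rewrite gt_eqF// ltr_wpDr.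
rewrite -mulr_natr -!natr1 /t; by field; rewrite r1 r2.
Qed.

End eppf.

Section stick_breaking_partition.
Context d (T : measurableType d) (R : realType) (Q : probability T R).
Variables (alpha theta : R) (W : nat -> {RV Q >-> R}).
Hypotheses (halpha : 0 <= alpha < 1) (htheta : - alpha < theta).
Hypothesis indepW : mutually_independent W.
Hypothesis lawW : forall j (U : set R), measurable U ->
  distribution Q (W j) U = real_beta_law (1 - alpha) (theta + alpha * j.+1%:R) U.

(** The weights obtained by breaking a unit stick with the variables from the [N]-th
one on. *)
Definition stick (N : nat) (t : T) : nat -> R :=
  stick_breaking (fun j => W (N + j)%N t).

(** The [N]-th remaining stick is broken as if one started with this parameter. *)
Definition shifted_theta (N : nat) : R := theta + alpha * N%:R.

Lemma stick_scons N t :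
  stick N t = scons (W N t) (fun x => (1 - W N t) * stick N.+1 t x).
Proof.
apply/funext => -[|x]; rewrite /stick /stick_breaking/=.
  by rewrite big_ord0 mulr1 addn0.
rewrite big_ord_recl/= addn0 mulrCA addnS addSn; congr (_ * (_ * _)).
by apply: eq_bigr => i _; rewrite /= /bump/= add1n addnS addSn.
Qed.

Lemma shifted_theta_gt N : - alpha < shifted_theta N.
Proof.
by rewrite (lt_le_trans htheta)// lerDl mulr_ge0//; case/andP: halpha.
Qed.

Lemma shifted_thetaS N : shifted_theta N.+1 = shifted_theta N + alpha.
Proof. by rewrite /shifted_theta -natr1 mulrDr mulr1 addrA. Qed.

Lemma slot_moment N i j : (\int[Q]_t (slot (i, j) (W N t))%:E =
  (beta_ratio (shifted_theta N) alpha i j)%:E)%E.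
Proof.
have a1 : 0 < 1 - alpha by rewrite subr_gt0; case/andP: halpha.
have b0 : 0 < theta + alpha * N.+1%:R.
  by rewrite -/(shifted_theta N.+1) shifted_thetaS -ltrBlDr sub0r shifted_theta_gt.
have := @beta_moment R (1 - alpha) (theta + alpha * N.+1%:R)
  (distribution Q (W N)) a1 b0 (lawW N) i j.
rewrite ge0_integral_distribution; last 2 first.
- by apply/measurable_EFinP; exact: measurable_slot.
- by move=> y; rewrite lee_fin slot_ge0.
move=> ->; rewrite /beta_ratio -/(shifted_theta N.+1) shifted_thetaS.
by congr ((_ / rising _ _)%:E); ring.
Qed.

Lemma stick_weight_itv01 N : {ae Q, forall t, 0 < W N t < 1}.
Proof.
have m01 : measurable (~` `]0%R, 1%R[ : set R) by exact: measurableC.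
exists (W N @^-1` ~` `]0%R, 1%R[); split => //.
- exact: measurable_RV_preimage.
- rewrite -[LHS]/(distribution Q (W N) _) lawW// /real_beta_law setICl.
  by rewrite integral_set0.
Qed.

Lemma sum_stick_breaking (w : nat -> R) n :
  \sum_(0 <= x < n) stick_breaking w x = 1 - \prod_(i < n) (1 - w i).
Proof.
elim: n => [|n ih]; first by rewrite big_geq// big_ord0 subrr.
rewrite big_nat_recr//= ih big_ord_recr/= /stick_breaking.
by ring.
Qed.

Lemma stick_breaking_like (w : nat -> R) : (forall j, 0 <= w j <= 1) ->
  distribution_like (stick_breaking w).
Proof.
move=> w01; have c0 n : 0 <= \prod_(i < n) (1 - w i).
  by apply: prodr_ge0 => i _; rewrite subr_ge0; case/andP: (w01 i).
have s0 x : 0 <= stick_breaking w x by rewrite mulr_ge0//; case/andP: (w01 x).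
split => //; apply: lime_le.
  by apply: is_cvg_nneseries => x _ _; rewrite lee_fin.
by apply: nearW => n; rewrite sumEFin lee_fin sum_stick_breaking gerBl.
Qed.

Lemma measurable_stick_breaking d' (T' : measurableType d') (w : nat -> T' -> R) x :
  (forall j, measurable_fun setT (w j)) ->
  measurable_fun setT (fun t => stick_breaking (w ^~ t) x).
Proof.
move=> mw; apply: measurable_funM => //.
by apply: measurable_prod => i _; apply: measurable_funB.
Qed.

Definition expected_sum (N : nat) (rs : seq nat) : \bar R :=
  (\int[Q]_t distinct_sum (powers rs) (stick N t))%E.

Lemma measurable_sum_stick N rs :
  measurable_fun setT (fun t => distinct_sum (powers rs) (stick N t)).
Proof.
apply: measurable_distinct_sum => x.
by apply: (@measurable_stick_breaking _ T (fun j => W (N + j)%N)) => j; exact: measurable_funP.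
Qed.

Lemma measurable_sum_stick_tail N rs : measurable_fun setT
  ((fun t => distinct_sum (powers rs) (stick N.+1 t)) : tail_type W N -> \bar R).
Proof.
apply: (@measurable_distinct_sum _ _ (tail_type W N)) => x.
apply: (@measurable_stick_breaking _ (tail_type W N) (fun j => W (N.+1 + j)%N)) => j.
by apply: measurable_tail; rewrite addSn ltnS leq_addr.
Qed.

Lemma expected_sum_ge0 N rs : (0 <= expected_sum N rs)%E.
Proof. by apply: integral_ge0 => t _; exact: distinct_sum_ge0. Qed.

Lemma expected_sum_le1 N rs : all (ltn 0%N) rs -> (expected_sum N rs <= 1)%E.
Proof.
move=> rs0; have <- : (\int[Q]_t cst 1 t = 1)%E.
  by rewrite integral_cst//= probability_setT mule1.
apply: ae_ge0_le_integral => //.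
- by move=> t _; exact: distinct_sum_ge0.
- exact: measurable_sum_stick.
- have := ae_foralln stick_weight_itv01; apply: filterS => t t01 _.
  apply: distinct_sum_le1; first by rewrite /positive_powers all_map.
  by apply: stick_breaking_like => j; have /andP[/ltW -> /ltW ->] := t01 (N + j)%N.
Qed.

(** Split off the first stick [W N]; the other sticks, after rescaling by [1 - W N],
are independent of it. *)
Lemma expected_sum_rec N rs : all (ltn 0%N) rs ->
  (expected_sum N rs =
   (beta_ratio (shifted_theta N) alpha 0 (sumn rs))%:E * expected_sum N.+1 rs +
   \sum_(j < size rs)
     (beta_ratio (shifted_theta N) alpha (nth 0%N rs j) (sumn rs - nth 0%N rs j))%:E
     * expected_sum N.+1 (remove rs j))%E.
Proof.
move=> rs0.
pose g rs t := distinct_sum (powers rs) (stick N.+1 t).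
have mslot e : measurable_fun setT (fun t => (slot e (W N t))%:E).
  by apply/measurable_EFinP; apply: measurableT_comp (measurable_funP _); exact: measurable_slot.
have mterm e rs' : measurable_fun setT (fun t => (slot e (W N t))%:E * g rs' t)%E.
  by apply: emeasurable_funM => //; exact: measurable_sum_stick.
have term0 e rs' t : (0 <= (slot e (W N t))%:E * g rs' t)%E.
  by rewrite mule_ge0 ?distinct_sum_ge0// lee_fin slot_ge0.
have mulE e rs' : (\int[Q]_t ((slot e (W N t))%:E * g rs' t) =
    (beta_ratio (shifted_theta N) alpha e.1 e.2)%:E * expected_sum N.+1 rs')%E.
  case: e => i j; rewrite integral_tail_mul ?slot_moment//.
  - exact: measurable_slot.
  - by move=> x; exact: slot_ge0.
  - exact: measurable_sum_stick_tail.
  - by move=> t; exact: distinct_sum_ge0.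
transitivity (\int[Q]_t ((slot (0, sumn rs)%N (W N t))%:E * g rs t +
    \sum_(j < size rs) (slot (nth 0%N rs j, sumn rs - nth 0%N rs j)%N (W N t))%:E
      * g (remove rs j) t))%E.
  apply: eq_integral => t _; rewrite stick_scons distinct_sum_scons; last first.
    by rewrite /positive_powers all_map.
  rewrite distinct_sum_scale -/(g rs t) size_map; congr (_ * _ + _)%E.
    by rewrite /slot/= expr0 mul1r.
  apply: eq_bigr => j _; rewrite remove_powers distinct_sum_scale muleA -EFinM.
  congr (_%:E * _)%E; rewrite (nth_map 0%N)// /slot/= expr0 mulr1; congr (_ * _ ^+ _).
  by rewrite (sumn_remove (ltn_ord j)) addKn.
rewrite ge0_integralD//; last 2 first.
- by move=> t _; apply: sume_ge0 => j _.
- exact: emeasurable_sum.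
rewrite mulE; congr (_ + _)%E.
by rewrite ge0_integral_sum//; apply: eq_bigr => j _; rewrite mulE.
Qed.

(** All factors of the quotient but the first are at most one; with
[t = theta + alpha] this first factor has the form [(t + alpha N) / (t + alpha N + 1 - alpha)]. *)
Lemma beta_ratio_le N n : (0 < n)%N ->
  0 <= beta_ratio (shifted_theta N) alpha 0 n <=
  (shifted_theta N + alpha) / (shifted_theta N + 1).
Proof.
have /andP[a0 a1] := halpha; have sN := shifted_theta_gt N.
have b0 : 0 < shifted_theta N + alpha by rewrite -ltrBlDr sub0r.
have c0 : 0 < shifted_theta N + 1 by rewrite (lt_trans b0)// ltrD2l.
case: n => // n _; rewrite /beta_ratio rising0 mul1r add0n.
have r0 := rising_gt0 n.+1 b0; have r1 := rising_gt0 n.+1 c0.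
rewrite divr_ge0 ?(ltW r0) ?(ltW r1)//= !risingSl -mulf_div.
rewrite ler_piMr ?divr_ge0 ?(ltW b0) ?(ltW c0)//.
have r2 : 0 < rising (shifted_theta N + 1 + 1) n by apply: rising_gt0; rewrite addr_gt0.
rewrite ler_pdivrMr// mul1r.
apply: ler_prod => i _; apply/andP; split.
  by apply: addr_ge0 => //; apply: addr_ge0 => //; exact: ltW.
by rewrite !lerD2r lerD2l ltW.
Qed.

End stick_breaking_partition.

Section contraction.
Variable R : realType.

(** Iterating the inequality bounds [D 0] by [C] times the product of the factors
[1 / (1 + kappa / (t + s i))], which vanishes because the harmonic series diverges. *)
Lemma harmonic_contraction (D : nat -> R) (C kappa t s : R) :
  0 < kappa -> 0 < t -> 0 <= s -> (forall i, `|D i| <= C) ->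
  (forall i, `|D i| <= (t + s * i%:R) / (t + s * i%:R + kappa) * `|D i.+1|) ->
  D 0%N = 0.
Proof.
move=> k0 t0 s0 DC Dstep.
pose b (i : nat) := t + s * i%:R.
have b0 i : 0 < b i by rewrite ltr_wpDr// mulr_ge0.
(* The product of the [1 + kappa / b i] is at least one plus their sum. *)
have grow L : `|D 0%N| * (1 + \sum_(i < L) kappa / b i) <= `|D L|.
  elim: L => [|L ih]; first by rewrite big_ord0 addr0 mulr1.
  have bL : 0 < b L / (b L + kappa) by rewrite divr_gt0// (addr_gt0 (b0 L) k0).
  rewrite -(ler_pM2l bL) (le_trans _ (Dstep L))// -/(b L).
  have S0 : 0 <= \sum_(i < L) kappa / b i.
    by apply: sumr_ge0 => i _; rewrite divr_ge0// ltW.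
  rewrite big_ord_recr/=; set S := \sum_(i < L) _ in ih S0 *.
  apply: le_trans ih; rewrite mulrCA ler_wpM2l//.
  rewrite mulrAC ler_pdivrMr; last exact: addr_gt0 (b0 L) k0.
  have -> : b L * (1 + (S + kappa / b L)) = b L * (1 + S) + kappa.
    have bL0 := lt0r_neq0 (b0 L); by field.
  rewrite (_ : (1 + S) * (b L + kappa) = b L * (1 + S) + kappa + S * kappa); last by ring.
  by rewrite lerDl mulr_ge0// ltW.
apply: normr0_eq0; apply/eqP; rewrite eq_le normr_ge0 andbT leNgt; apply/negP => D0.
apply: (@dvg_harmonic R); apply: nondecreasing_is_cvgn.
  by apply: nondecreasing_series => i _ _; exact: harmonic_ge0.
exists (C / `|D 0%N| * ((t + s) / kappa)) => _ [L _ <-].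
rewrite -ler_pdivrMr ?divr_gt0 ?ltr_wpDr// invf_div.
rewrite ler_pdivlMr// mulrC.
apply: le_trans (DC L); apply: le_trans (grow L); rewrite ler_wpM2l//.
rewrite /series/= big_mkord mulr_suml (le_trans _ (ler_wpDl _ (lexx _)))//.
apply: ler_sum => i _; rewrite /harmonic/= mulrCA ler_wpM2l ?(ltW k0)//.
have ts : 0 < t + s by rewrite ltr_wpDr.
rewrite -invfM lef_pV2 ?posrE ?mulr_gt0// /b -natr1.
have i0 : 0 <= i%:R :> R by [].
by have := mulr_ge0 s0 i0; have := mulr_ge0 (ltW t0) i0; nra.
Qed.

End contraction.

Section eppf_bound.
Variable R : realType.

Lemma rising_add (x : R) n m : rising x (n + m) = rising x n * rising (x + n%:R) m.
Proof.
rewrite /rising big_split_ord/=; congr (_ * _); apply: eq_bigr => i _.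
by rewrite natrD addrA.
Qed.

Lemma eppf_gt0 (theta alpha : R) rs : 0 <= alpha < 1 -> - alpha < theta ->
  0 < eppf theta alpha rs.
Proof.
move=> /andP[a0 a1] ta; have t0 : 0 < theta + alpha by rewrite -ltrBlDr sub0r.
have t1 : 0 < theta + 1 by rewrite (lt_trans t0)// ltrD2l.
rewrite mulr_gt0 ?divr_gt0 ?steps_gt0 ?rising_gt0//.
by apply: prodr_gt0 => r _; rewrite rising_gt0// subr_gt0.
Qed.

(** What matters is that the bound does not depend on [theta]. *)
Lemma eppf_le (theta alpha : R) rs : 0 <= alpha < 1 -> - alpha < theta ->
  all (ltn 0%N) rs ->
  eppf theta alpha rs <=
  (1 - alpha)^-1 ^+ (sumn rs - size rs) * \prod_(r <- rs) rising (1 - alpha) r.-1.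
Proof.
move=> /andP[a0 a1] ta rs0.
have k0 : 0 < 1 - alpha by rewrite subr_gt0.
have t0 : 0 < theta + alpha by rewrite -ltrBlDr sub0r.
have t1 : 0 < theta + 1 by rewrite (lt_trans t0)// ltrD2l.
have szs : (size rs <= sumn rs)%N.
  elim: rs rs0 => //= r rs ih /andP[r0 /ih]; lia.
rewrite /eppf ler_wpM2r//.
  by apply: prodr_ge0 => r _; rewrite rising_ge0// ltW.
have -> : (sumn rs).-1 = ((size rs).-1 + (sumn rs - size rs))%N.
  by case: rs rs0 szs => //= r rs /andP[r0 _]; lia.
set k := (size rs).-1; set m := (_ - _)%N; rewrite rising_add.
rewrite invfM mulrA -[leRHS]mul1r ler_pM ?divr_ge0 ?invr_ge0//.
- exact: ltW (steps_gt0 _ t0 a0).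
- exact: ltW (rising_gt0 _ t1).
- by apply: rising_ge0; rewrite addr_ge0// ltW.
- rewrite ler_pdivrMr ?rising_gt0// mul1r.
  apply: ler_prod => i _; apply/andP; split.
    by rewrite addr_ge0 ?mulr_ge0// ltW.
  by rewrite -addrA -addrA lerD2l lerD ?(ltW a1)// ler_piMr// ltW.
- have r0 : 0 < rising (theta + 1 + k%:R) m by apply: rising_gt0; rewrite ltr_wpDr.
  rewrite exprVn lef_pV2 ?posrE ?exprn_gt0//.
  rewrite -[m in leLHS]card_ord -prodr_const.
  apply: ler_prod => i _; rewrite (ltW k0)/=.
  rewrite -addrA -addrA; apply: (@le_trans _ _ (theta + 1)).
    by rewrite [leRHS]addrC lerD2l ltW.
  by rewrite lerD2l lerDl addr_ge0.
Qed.

End eppf_bound.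

Section eppf_formula.
Context d (T : measurableType d) (R : realType) (Q : probability T R).
Variables (alpha theta : R) (W : nat -> {RV Q >-> R}).
Hypotheses (halpha : 0 <= alpha < 1) (htheta : - alpha < theta).
Hypothesis indepW : mutually_independent W.
Hypothesis lawW : forall j (U : set R), measurable U ->
  distribution Q (W j) U = real_beta_law (1 - alpha) (theta + alpha * j.+1%:R) U.

(** Induction on the number of classes: in the recursion the terms where a class has
been removed are known, so that the difference between the two sides is multiplied
by [beta_ratio] at each step [N].  It is bounded in [N], hence zero. *)
Lemma expected_sum_eppf N rs : all (ltn 0%N) rs ->
  expected_sum W N rs = (eppf (shifted_theta alpha theta N) alpha rs)%:E.
Proof.
move: {2}(size rs) (leqnn (size rs)) => k; elim: k rs N => [|k ih] rs N.
  rewrite leqn0 size_eq0 => /eqP -> _.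
  rewrite /expected_sum/= integral_cst//= probability_setT mule1.
  by rewrite /eppf/= steps0 rising0 big_nil divr1 mulr1.
move=> rsk rs0; have [->|rsN] := eqVneq rs [::]; first by rewrite ih.
have k0 : (0 < size rs)%N by rewrite lt0n size_eq0.
pose t := shifted_theta alpha theta N + alpha.
have /andP[a0 a1] := halpha.
have sN M := shifted_theta_gt halpha htheta M.
have t0 : 0 < t by rewrite -ltrBlDr sub0r.
have efin M : expected_sum W M rs = (fine (expected_sum W M rs))%:E.
  rewrite fineK// ge0_fin_numE ?expected_sum_ge0//.
  by rewrite (le_lt_trans (expected_sum_le1 lawW _ rs0))// ltry.
pose D i := fine (expected_sum W (N + i)%N rs) - eppf (shifted_theta alpha theta (N + i)) alpha rs.
have b i : t + alpha * i%:R = shifted_theta alpha theta (N + i) + alpha.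
  by rewrite /t /shifted_theta natrD; ring.
suff : D 0%N = 0.
  by rewrite /D addn0 => /eqP; rewrite subr_eq0 => /eqP E; rewrite efin E.
pose C := (1 - alpha)^-1 ^+ (sumn rs - size rs) * \prod_(r <- rs) rising (1 - alpha) r.-1.
apply: (@harmonic_contraction R D (1 + C) (1 - alpha) t alpha) => //.
- by rewrite subr_gt0.
- move=> i; rewrite (le_trans (ler_normB _ _))// lerD//.
    rewrite ger0_norm ?fine_ge0 ?expected_sum_ge0//.
    by rewrite -lee_fin -efin (expected_sum_le1 lawW).
  by rewrite gtr0_norm ?eppf_gt0// eppf_le.
- move=> i; rewrite b.
  have -> : shifted_theta alpha theta (N + i) + alpha + (1 - alpha) =
      shifted_theta alpha theta (N + i) + 1 by ring.
  have /andP[r0 r1] := beta_ratio_le halpha htheta (N + i) (sumn_gt0 rs0 k0).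
  apply: le_trans (ler_wpM2r (normr_ge0 _) r1).
  rewrite -{1}(ger0_norm r0) -normrM /D le_eqVlt; apply/orP; left; apply/eqP.
  congr `|_|.
  have := expected_sum_rec halpha htheta indepW lawW (N + i) rs0.
  rewrite efin (efin (N + i).+1) addnS.
  under eq_bigr => j _.
    rewrite ih ?all_remove//; last first.
      by rewrite size_remove//; move: rsk k0; case: (size rs).
    rewrite -EFinM; over.
  rewrite sumEFin -EFinM -EFinD => -[->].
  by rewrite [X in _ - X]eppf_rec// shifted_thetaS [fine _]/=; ring.
Qed.

End eppf_formula.

(** * Moments under the Poisson-Dirichlet law *)

Section PDP_moments.
Variables (R : realType) (alpha theta : R).
Hypotheses (halpha : 0 <= alpha < 1) (htheta : - alpha < theta).
Variable P : probability (ranked_simplex R) R.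
Hypothesis hP : is_PDP alpha theta P.

Lemma measurable_mass i : measurable_fun setT (fun s : ranked_simplex R => s i).
Proof.
move=> _ A mA; apply: sub_gen_smallest.
by exists i => //; exists A.
Qed.

Lemma measurable_distinct_sum_mass es :
  measurable_fun setT (fun s : ranked_simplex R => distinct_sum es s).
Proof. by apply: measurable_distinct_sum => i; exact: measurable_mass. Qed.

Lemma mass_distribution_like (s : ranked_simplex R) : distribution_like s.
Proof. by split; [exact: mass_ge0|rewrite mass_sum]. Qed.

(** Sums over distinct indices do not see the order of the weights, so the ranked
weights can be replaced by the stick-breaking ones. *)
Lemma integral_PDP_powers rs : all (ltn 0%N) rs ->
  (\int[P]_s distinct_sum (powers rs) s = (eppf theta alpha rs)%:E)%E.
Proof.
move=> rs0; have [d [T [Q [W [V [indepW lawW rankV PV]]]]]] := hP.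
have -> : theta = shifted_theta alpha theta 0 by rewrite /shifted_theta mulr0 addr0.
rewrite -(expected_sum_eppf halpha htheta indepW lawW)//.
transitivity (\int[distribution Q V]_s distinct_sum (powers rs) s)%E.
  by apply: eq_measure_integral => A mA _; exact: PV.
rewrite ge0_integral_distribution//; last 2 first.
- exact: measurable_distinct_sum_mass.
- by move=> s; exact: distinct_sum_ge0.
apply: ge0_ae_eq_integral => //.
- exact: measurableT_comp (measurable_distinct_sum_mass _) (measurable_funP V).
- exact: measurable_sum_stick.
- by move=> t _; exact: distinct_sum_ge0.
- by move=> t _; exact: distinct_sum_ge0.
apply: filterS rankV => t [sigma sb VE] _ /=.
rewrite -(distinct_sum_bij (powers rs) (stick W 0 t) sb).
by congr distinct_sum; apply/funext => i; rewrite VE.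
Qed.

(** The predictive probability that the next individual joins the class of size [a]. *)
Lemma eppf_cat rs1 a rs2 : (0 < a)%N -> all (ltn 0%N) (rs1 ++ rs2) ->
  eppf theta alpha (rs1 ++ a.+1 :: rs2) =
  eppf theta alpha (rs1 ++ a :: rs2) * (a%:R - alpha) / (theta + (sumn (rs1 ++ a :: rs2))%:R).
Proof.
move=> a0 rs0; rewrite /eppf !size_cat/= !addnS.
have -> : sumn (rs1 ++ a.+1 :: rs2) = (sumn (rs1 ++ a :: rs2)).+1.
  by rewrite !sumn_cat/= addSn addnS.
have : (0 < sumn (rs1 ++ a :: rs2))%N by rewrite sumn_cat/= addnCA addn_gt0 a0.
case: (sumn _) => // n _; rewrite !big_cat !big_cons !succnK.
case: a a0 => // a _; rewrite !succnK !risingS.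
have [t1 tn] : rising (theta + 1) n != 0 /\ theta + 1 + n%:R != 0.
  have t1 : 0 < theta + 1.
    case/andP: halpha => _ a1.
    by rewrite -ltrBlDr sub0r (lt_trans _ htheta)// ltrN2.
  by split; rewrite gt_eqF ?rising_gt0// ltr_wpDr.
rewrite (_ : theta + n.+1%:R = theta + 1 + n%:R); last by rewrite -natr1; ring.
rewrite -[a.+1%:R]natr1/=.
by field; rewrite t1 tn.
Qed.

(** Induction on [b], since [x^a (1 - x)^(b+1) = x^a (1 - x)^b - x^(a+1) (1 - x)^b]. *)
Lemma integral_PDP_slot rs1 a b rs2 : (0 < a)%N -> all (ltn 0%N) (rs1 ++ rs2) ->
  (\int[P]_s distinct_sum (powers rs1 ++ (a, b) :: powers rs2) s =
   (eppf theta alpha (rs1 ++ a :: rs2) *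
    (rising (theta + (sumn (rs1 ++ rs2))%:R + alpha) b /
     rising (theta + (sumn (rs1 ++ a :: rs2))%:R) b))%:E)%E.
Proof.
move=> + rs0; elim: b a => [|b ih] a a0.
  rewrite !rising0 divr1 mulr1 -integral_PDP_powers.
    by rewrite /powers map_cat.
  by move: rs0; rewrite !all_cat/= a0.
have split : (\int[P]_s distinct_sum (powers rs1 ++ (a, b) :: powers rs2) s =
    \int[P]_s distinct_sum (powers rs1 ++ (a.+1, b) :: powers rs2) s +
    \int[P]_s distinct_sum (powers rs1 ++ (a, b.+1) :: powers rs2) s)%E.
  rewrite -ge0_integralD//; last 4 first.
  - by move=> s _; exact: distinct_sum_ge0.
  - exact: measurable_distinct_sum_mass.
  - by move=> s _; exact: distinct_sum_ge0.
  - exact: measurable_distinct_sum_mass.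
  apply: eq_integral => s _; apply: distinct_sum_slotD => x.
  by rewrite mass_ge0 distribution_like_le1//; exact: mass_distribution_like.
move: split; rewrite !ih//.
have : (0 <= \int[P]_s distinct_sum (powers rs1 ++ (a, b.+1) :: powers rs2) s)%E.
  by apply: integral_ge0 => s _; exact: distinct_sum_ge0.
case: integral => // z _; rewrite -EFinD => -[E]; congr (_%:E).
rewrite (canRL (addKr _) (esym E)) eppf_cat//.
have sE : sumn (rs1 ++ a.+1 :: rs2) = (sumn (rs1 ++ a :: rs2)).+1.
  by rewrite !sumn_cat/= addSn addnS.
have sE' : sumn (rs1 ++ a :: rs2) = (sumn (rs1 ++ rs2) + a)%N.
  by rewrite !sumn_cat/= addnCA addnC.
rewrite sE sE'; set n0 := sumn _; set F := eppf _ _ _.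
set x := theta + (n0 + a)%:R; have x0 : 0 < x.
  have [n0_ge0 a_ge1] : 0 <= n0%:R :> R /\ 1 <= a%:R :> R by rewrite ler0n ler1n.
  by case/andP: halpha => _ a1; rewrite /x natrD; move: htheta; lra.
rewrite -[(n0 + a).+1%:R]natr1 [theta + (_ + 1)]addrA -/x.
have x1 : 0 < x + b%:R by rewrite ltr_wpDr.
have r0 : rising x b != 0 by rewrite gt_eqF// rising_gt0.
have r1 : rising (x + 1) b = rising x b * (x + b%:R) / x.
  by apply: (mulfI (lt0r_neq0 x0)); rewrite -risingSl risingS [RHS]mulrCA divff ?mulr1// gt_eqF.
rewrite r1 !risingS.
have -> : theta + n0%:R + alpha + b%:R = x + b%:R - (a%:R - alpha).
  by rewrite /x natrD; ring.
have x0' := lt0r_neq0 x0; have x1' := lt0r_neq0 x1.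
by field; rewrite r0 x0' x1'.
Qed.

End PDP_moments.

Section posterior_mean.
Variables (R : realType) (alpha theta : R).

(** The moment [E((1 - B)^m)] of a Beta(x, s - x) variable. *)
Definition beta_ratio_tail (x s : R) (m : nat) : R := rising (s - x) m / rising s m.

(** Truncation of the series of [E(- log B) = psi(s) - psi(x)] for a Beta(x, s - x)
variable, with [psi] the digamma function. *)
Definition log_moment (x s : R) (M : nat) : R :=
  \sum_(i < M) i.+1%:R^-1 * beta_ratio_tail x s i.+1.

(** The entropy is the expectation of [- log] of the mass of the species of one more
individual.  After observing [rs] this individual is of a new species or of the
[j]-th one with probabilities [(theta + k alpha) / tau] and [(r_j - alpha) / tau], and
the mass of its species then has a Beta law with first parameter [1 - alpha] or
[r_j - alpha + 1]. *)
Definition posterior_mean (M : nat) (rs : seq nat) : R :=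
  let tau := theta + (sumn rs)%:R in
  ((theta + (size rs)%:R * alpha) * log_moment (1 - alpha) (tau + 1) M +
   \sum_(j < size rs) ((nth 0%N rs j)%:R - alpha) *
      log_moment ((nth 0%N rs j)%:R - alpha + 1) (tau + 1) M) / tau.

(** The expansion of [- x log x] into the terms [x (1 - x)^m / m], cut at [m = M]. *)
Definition truncated_entropy (M : nat) (p : nat -> R) : \bar R :=
  (\sum_(i < M) (i.+1%:R^-1)%:E * slot_sum (1, i.+1)%N p)%E.

(** The predictive probability of a new species. *)
Lemma eppf_rcons rs : (0 < size rs)%N -> all (ltn 0%N) rs ->
  eppf theta alpha (rs ++ [:: 1%N]) = eppf theta alpha rs *
    (theta + (size rs)%:R * alpha) / (theta + (sumn rs)%:R).
Proof.
move=> k0 rs0; have := sumn_gt0 rs0 k0.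
rewrite /eppf sumn_cat size_cat/= addn0 !addn1 !succnK big_cat big_seq1/= rising0 mulr1.
case: (size rs) k0 => // k _; case: (sumn rs) => // n _; rewrite !succnK stepsS risingS.
rewrite (_ : theta + n.+1%:R = theta + 1 + n%:R); last by rewrite -natr1; ring.
rewrite (_ : theta + k.+1%:R * alpha = theta + alpha + k%:R * alpha); last first.
  by rewrite -natr1; ring.
by rewrite invfM; ring.
Qed.

End posterior_mean.

Section posterior_mean_integral.
Variables (R : realType) (alpha theta : R).
Hypotheses (halpha : 0 <= alpha < 1) (htheta : - alpha < theta).
Variable P : probability (ranked_simplex R) R.
Hypothesis hP : is_PDP alpha theta P.

(** The factor [x (1 - x)^m] falls on a species that is new or the [j]-th one of [rs]. *)
Lemma integral_PDP_slot_sum m rs : (0 < size rs)%N -> all (ltn 0%N) rs ->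
  (\int[P]_s (slot_sum (1, m)%N s * distinct_sum (powers rs) s) =
   (eppf theta alpha rs * (((theta + (size rs)%:R * alpha) *
      beta_ratio_tail (1 - alpha) (theta + (sumn rs)%:R + 1) m +
     \sum_(j < size rs) ((nth 0%N rs j)%:R - alpha) *
      beta_ratio_tail ((nth 0%N rs j)%:R - alpha + 1) (theta + (sumn rs)%:R + 1) m)
       / (theta + (sumn rs)%:R)))%:E)%E.
Proof.
move=> k0 rs0.
have mds es := @measurable_distinct_sum_mass R es.
transitivity (\int[P]_s (distinct_sum (powers rs ++ (1%N, m) :: powers [::]) s +
  \sum_(j < size rs) distinct_sum
    (powers (take j rs) ++ ((nth 0%N rs j).+1, m) :: powers (drop j.+1 rs)) s))%E.
  apply: eq_integral => s _; rewrite slot_sum_mul//; last 2 first.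
  - by rewrite /positive_powers all_map.
  - exact: mass_distribution_like.
  rewrite -cats1 size_map; congr (_ + _)%E; apply: eq_bigr => j _.
  rewrite /raise /powers -map_take -map_drop (nth_map 0%N)//=.
  by rewrite add1n addn0.
rewrite ge0_integralD; [|exact: measurableT|by move=> s _; exact: distinct_sum_ge0
  |exact: mds|by move=> s _; apply: sume_ge0 => j _; exact: distinct_sum_ge0
  |by apply: emeasurable_sum => j; exact: mds].
rewrite ge0_integral_sum; [|exact: measurableT|by move=> j; exact: mds
  |by move=> j s _; exact: distinct_sum_ge0].
rewrite (integral_PDP_slot halpha htheta hP)//; last by rewrite cats0.
have n0 := sumn_gt0 rs0 k0.
rewrite eppf_rcons// cats0.
have -> : sumn (rs ++ [:: 1%N]) = (sumn rs).+1 by rewrite sumn_cat/= addn0 addn1.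
under eq_bigr => j _.
  have rsE : take j rs ++ nth 0%N rs j :: drop j.+1 rs = rs.
    by rewrite -drop_nth// cat_take_drop.
  have r0 : (0 < nth 0%N rs j)%N by apply: (allP rs0); rewrite mem_nth.
  have r0' := @all_remove rs _ j rs0.
  rewrite (integral_PDP_slot halpha htheta hP)//.
  rewrite eppf_cat// rsE.
  have -> : sumn (take j rs ++ (nth 0%N rs j).+1 :: drop j.+1 rs) = (sumn rs).+1.
    transitivity (sumn (take j rs ++ nth 0%N rs j :: drop j.+1 rs)).+1.
      by rewrite !sumn_cat/= addSn addnS.
    by rewrite rsE.
  have -> : (sumn (take j rs ++ drop j.+1 rs))%:R = (sumn rs)%:R - (nth 0%N rs j)%:R :> R.
    by rewrite (sumn_remove (ltn_ord j)) natrD addrAC subrr add0r.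
  over.
rewrite sumEFin -EFinD; congr (_%:E).
rewrite -natr1 addrA.
rewrite mulrDl mulrDr mulr_suml mulr_sumr /beta_ratio_tail; congr (_ + _).
  by rewrite (_ : _ + 1 - (1 - alpha) = theta + (sumn rs)%:R + alpha); ring.
apply: eq_bigr => j _.
rewrite (_ : theta + (sumn rs)%:R + 1 - ((nth 0%N rs j)%:R - alpha + 1) =
  theta + ((sumn rs)%:R - (nth 0%N rs j)%:R) + alpha); ring.
Qed.

Lemma measurable_slot_sum e : measurable_fun setT (fun s : ranked_simplex R => slot_sum e s).
Proof.
have := @measurable_distinct_sum_mass R [:: e].
by congr (measurable_fun _ _); apply/funext => s /=; apply: eq_eseriesr => x _; rewrite mule1.
Qed.

Lemma truncated_entropy_ge0 M (p : nat -> R) : (0 <= truncated_entropy M p)%E.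
Proof.
by apply: sume_ge0 => i _; rewrite mule_ge0 ?slot_sum_ge0// lee_fin invr_ge0.
Qed.

Lemma measurable_truncated_entropy M :
  measurable_fun setT (fun s : ranked_simplex R => truncated_entropy M s).
Proof.
apply: emeasurable_sum => i; apply: emeasurable_funM => //.
exact: measurable_slot_sum.
Qed.

Lemma integral_PDP_truncated_entropy M rs : (0 < size rs)%N -> all (ltn 0%N) rs ->
  (\int[P]_s (truncated_entropy M s * distinct_sum (powers rs) s) =
   (eppf theta alpha rs * posterior_mean alpha theta M rs)%:E)%E.
Proof.
move=> k0 rs0.
transitivity (\int[P]_s \sum_(i < M) ((i.+1%:R^-1)%:E *
    (slot_sum (1, i.+1)%N s * distinct_sum (powers rs) s)))%E.
  apply: eq_integral => s _; rewrite ge0_sume_distrl; last first.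
    by move=> i _; rewrite mule_ge0 ?slot_sum_ge0// lee_fin invr_ge0.
  by apply: eq_bigr => i _; rewrite muleA.
have mterm e : measurable_fun setT (fun s : ranked_simplex R =>
    (slot_sum e s * distinct_sum (powers rs) s)%E).
  by apply: emeasurable_funM; [exact: measurable_slot_sum|exact: measurable_distinct_sum_mass].
have term0 e (s : ranked_simplex R) : (0 <= slot_sum e s * distinct_sum (powers rs) s)%E.
  by rewrite mule_ge0 ?slot_sum_ge0 ?distinct_sum_ge0.
rewrite ge0_integral_sum//; last 2 first.
- by move=> i; apply: emeasurable_funM.
- by move=> i s _; rewrite mule_ge0// lee_fin invr_ge0.
under eq_bigr => i _.
  rewrite ge0_integralZl//.
  rewrite integral_PDP_slot_sum// -EFinM; over.
rewrite sumEFin; congr (_%:E).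
rewrite /posterior_mean /log_moment.
under [X in _ = _ * ((_ + X) / _)]eq_bigr do rewrite mulr_sumr.
rewrite exchange_big/= mulr_sumr -big_split/= mulr_suml mulr_sumr.
apply: eq_bigr => i _; rewrite mulrCA; congr (_ * _); rewrite mulrA; congr (_ / _).
rewrite mulrDr mulr_sumr; congr (_ + _); first by rewrite mulrCA.
by apply: eq_bigr => j _; rewrite mulrCA.
Qed.

End posterior_mean_integral.

(** * Increments of the posterior mean *)

Section log_moment_bounds.
Variable R : realType.
Implicit Types x s : R.

Lemma log_momentS x s M : log_moment x s M.+1 =
  log_moment x s M + M.+1%:R^-1 * beta_ratio_tail x s M.+1.
Proof. by rewrite /log_moment big_ord_recr. Qed.

Lemma log_moment0 x s : log_moment x s 0 = 0.
Proof. by rewrite /log_moment big_ord0. Qed.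

Lemma beta_ratio_tail0 x s : beta_ratio_tail x s 0 = 1.
Proof. by rewrite /beta_ratio_tail !rising0 divr1. Qed.

Lemma beta_ratio_tail_ge0 x s m : 0 < s -> x <= s -> 0 <= beta_ratio_tail x s m.
Proof.
move=> s0 xs; rewrite divr_ge0 ?rising_ge0 ?subr_ge0//.
exact: ltW.
Qed.

Lemma beta_ratio_tail_le1 x s m : 0 <= x -> 0 < s -> x <= s -> beta_ratio_tail x s m <= 1.
Proof.
move=> x0 s0 xs; rewrite ler_pdivrMr ?rising_gt0// mul1r.
apply: ler_prod => i _; apply/andP; split.
  by rewrite addr_ge0// subr_ge0.
by rewrite lerD2r gerBl.
Qed.

(** In the limit this is [psi(x + 1) - psi(x) = 1 / x]; the truncated sums telescope
exactly, with a remainder that is a Beta moment. *)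
Lemma log_moment_shift x s M : 0 < x -> 0 < s ->
  log_moment x s M - log_moment (x + 1) s M = (1 - beta_ratio_tail x s M) / x.
Proof.
move=> x0 s0; elim: M => [|M ih].
  by rewrite !log_moment0 beta_ratio_tail0 !subrr mul0r.
rewrite !log_momentS opprD addrACA ih /beta_ratio_tail.
rewrite (risingS s) (risingS (s - x)) (risingSl (s - (x + 1))).
have -> : s - (x + 1) + 1 = s - x by ring.
have M0 : M.+1%:R != 0 :> R by rewrite pnatr_eq0.
have sM : s + M%:R != 0 by rewrite gt_eqF// ltr_wpDr.
have r0 : rising s M != 0 by rewrite gt_eqF// rising_gt0.
have x0' := lt0r_neq0 x0.
rewrite -natr1 in M0 *.
by field; rewrite r0 sM M0 x0'.
Qed.

(** In the limit this is [psi(s + 1) - psi(s) = 1 / s]. *)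
Lemma log_moment_shift_scale x s M : 0 < s ->
  log_moment x (s + 1) M - log_moment x s M = (1 - beta_ratio_tail x (s + 1) M) / s.
Proof.
move=> s0; elim: M => [|M ih].
  by rewrite !log_moment0 beta_ratio_tail0 !subrr mul0r.
rewrite !log_momentS opprD addrACA ih /beta_ratio_tail.
rewrite (risingSl s) (risingSl (s - x)) !risingS.
have -> : s + 1 - x = s - x + 1 by ring.
have M0 : M.+1%:R != 0 :> R by rewrite pnatr_eq0.
have sM : s + 1 + M%:R != 0 by rewrite gt_eqF// ltr_wpDr// addr_gt0.
have r0 : rising (s + 1) M != 0 by rewrite gt_eqF// rising_gt0// addr_gt0.
have s0' := lt0r_neq0 s0.
rewrite -natr1 in M0 *.
by field; rewrite r0 sM M0 s0'.
Qed.

Lemma log_moment_ge0 x s M : 0 < s -> x <= s -> 0 <= log_moment x s M.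
Proof.
move=> s0 xs; apply: sumr_ge0 => i _.
by rewrite mulr_ge0 ?invr_ge0 ?beta_ratio_tail_ge0.
Qed.

(** The numerators have [s - x <= 0] as first factor, and the others are nonnegative. *)
Lemma log_moment_le0 x s M : 0 < s -> s <= x -> x <= s + 1 -> log_moment x s M <= 0.
Proof.
move=> s0 sx xs; apply: sumr_le0 => i _.
rewrite mulr_ge0_le0 ?invr_ge0// /beta_ratio_tail risingSl.
rewrite -mulrA mulr_le0_ge0 ?subr_le0// divr_ge0//.
  by rewrite rising_ge0// addrAC subr_ge0.
by rewrite rising_ge0// ltW.
Qed.

(** Raising [x] by one costs at most [1 / x], and after at most [s - x + 1] such steps [x]
exceeds [s], where the sum is nonpositive. *)
Lemma log_moment_le x s M : 0 < x -> x <= s -> log_moment x s M <= (s - x + 1) / x.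
Proof.
move=> x0 xs.
have H N : forall x, 0 < x -> x + N%:R <= s < x + N%:R + 1 ->
    log_moment x s M <= N.+1%:R / x.
  elim: N => [|N ih] {x0 xs}x x0 /andP[xs sx].
    have s0 : 0 < s by rewrite (lt_le_trans x0)// (le_trans _ xs)// addr0.
    rewrite -(subrK (log_moment (x + 1) s M) (log_moment x s M)) log_moment_shift//.
    rewrite addr0 in xs sx.
    apply: (@le_trans _ _ ((1 - beta_ratio_tail x s M) / x)).
      by rewrite gerDl log_moment_le0 ?lerD2r// ltW.
    by rewrite ler_pM2r ?invr_gt0// gerBl beta_ratio_tail_ge0.
  have xs' : x <= s by rewrite (le_trans _ xs)// lerDl.
  have s0 : 0 < s by rewrite (lt_le_trans x0).
  have x1 : 0 < x + 1 by rewrite addr_gt0.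
  rewrite -(subrK (log_moment (x + 1) s M) (log_moment x s M)) log_moment_shift//.
  have -> : N.+2%:R / x = N.+1%:R / x + 1 / x by rewrite -[N.+2%:R]natr1 mulrDl.
  rewrite addrC lerD//.
    apply: (le_trans (ih (x + 1) x1 _)).
      by rewrite -addrA [1 + _]addrC natr1 xs.
    by rewrite ler_pM2l// lef_pV2 ?posrE// lerDl.
  by rewrite ler_pM2r ?invr_gt0// gerBl beta_ratio_tail_ge0.
have sx0 : 0 <= s - x by rewrite subr_ge0.
have /andP[t1 t2] := truncn_itv sx0.
apply: (le_trans (H (Num.truncn (s - x)) x x0 _)).
  by rewrite -lerBrDl t1/= -addrA -ltrBlDl natr1.
by rewrite ler_pM2r ?invr_gt0// -natr1 lerD2r.
Qed.

End log_moment_bounds.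

Section posterior_mean_increment.
Variables (R : realType) (alpha theta : R).
Hypotheses (halpha : 0 <= alpha < 1) (htheta : - alpha < theta).

(** The unnormalized mixture, with total weight [theta + n]; separating the function
[G] from the weights lets one vary the two separately. *)
Definition predictive_sum (G : R -> R) (rs : seq nat) : R :=
  (theta + (size rs)%:R * alpha) * G (1 - alpha) +
  \sum_(r <- rs) (r%:R - alpha) * G (r%:R - alpha + 1).

Definition posterior_mass (rs : seq nat) : R := theta + (sumn rs)%:R.

Lemma posterior_meanE M rs : posterior_mean alpha theta M rs =
  predictive_sum (fun x => log_moment x (posterior_mass rs + 1) M) rs / posterior_mass rs.
Proof.
by rewrite /posterior_mean /predictive_sum (big_nth 0%N) big_mkord.
Qed.

Lemma predictive_sumB G1 G2 rs : predictive_sum (fun x => G1 x - G2 x) rs =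
  predictive_sum G1 rs - predictive_sum G2 rs.
Proof.
rewrite /predictive_sum mulrBr opprD [RHS]addrACA; congr (_ + _).
by rewrite -sumrB; apply: eq_bigr => r _; rewrite mulrBr.
Qed.

Lemma predictive_sum_cst L rs : predictive_sum (fun=> L) rs = posterior_mass rs * L.
Proof.
rewrite /predictive_sum -mulr_suml -mulrDl /posterior_mass; congr (_ * _).
rewrite sumrB -natr_sum -sumnE big_const_seq count_predT iter_addr_0 -mulr_natl.
by ring.
Qed.

Lemma predictive_sum_ge0 G rs : (0 < size rs)%N -> all (ltn 0%N) rs ->
  0 <= G (1 - alpha) -> (forall r, r \in rs -> 0 <= G (r%:R - alpha + 1)) ->
  0 <= predictive_sum G rs.
Proof.
move=> k0 rs0 G0 Gr; have /andP[a0 a1] := halpha.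
apply: addr_ge0.
  rewrite mulr_ge0//; case: (size rs) k0 => // k _; rewrite -natr1.
  have ka : 0 <= k%:R * alpha by rewrite mulr_ge0.
  by move: htheta; lra.
rewrite big_seq; apply: sumr_ge0 => r rrs; rewrite mulr_ge0 ?Gr// subr_ge0.
have : (1 <= r)%N by apply: (allP rs0).
by rewrite -(ler_nat R); lra.
Qed.

Lemma predictive_sum_le G L rs : (0 < size rs)%N -> all (ltn 0%N) rs ->
  G (1 - alpha) <= L -> (forall r, r \in rs -> G (r%:R - alpha + 1) <= L) ->
  predictive_sum G rs <= posterior_mass rs * L.
Proof.
move=> k0 rs0 GL Gr; rewrite -predictive_sum_cst -subr_ge0 -predictive_sumB.
by apply: predictive_sum_ge0 => // [|r rrs]; rewrite subr_ge0// Gr.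
Qed.

Lemma posterior_mass_gt0 rs : (0 < size rs)%N -> all (ltn 0%N) rs -> 0 < posterior_mass rs.
Proof.
move=> k0 rs0; have := sumn_gt0 rs0 k0; rewrite -(ler_nat R) /posterior_mass.
by case/andP: halpha; move: htheta; lra.
Qed.

Lemma class_parameter_range rs r : r \in rs -> all (ltn 0%N) rs ->
  1 - alpha <= r%:R - alpha + 1 <= posterior_mass rs + 1.
Proof.
move=> rrs rs0; have r1 : (1 <= r)%N by apply: (allP rs0).
have rs' : (r <= sumn rs)%N.
  by rewrite sumnE (big_rem r)//= leq_addr.
move: r1 rs'; rewrite -!(ler_nat R) /posterior_mass.
by case/andP: halpha; move: htheta; lra.
Qed.

Definition log_moment_cap (rs : seq nat) : R := (posterior_mass rs + 1 + alpha) / (1 - alpha).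

Lemma log_moment_capP M rs x : 1 - alpha <= x <= posterior_mass rs + 1 ->
  0 <= log_moment x (posterior_mass rs + 1) M <= log_moment_cap rs.
Proof.
move=> /andP[ax xm]; have a1 : 0 < 1 - alpha by case/andP: halpha; lra.
have x0 : 0 < x by apply: lt_le_trans ax.
have m0 : 0 < posterior_mass rs + 1 by apply: lt_le_trans xm.
rewrite log_moment_ge0//= (le_trans (log_moment_le M x0 xm))// /log_moment_cap.
apply: ler_pM => //; first by lra.
- by rewrite invr_ge0 ltW.
- by lra.
- by rewrite lef_pV2 ?posrE.
Qed.

Lemma posterior_mean_bounds M rs : (0 < size rs)%N -> all (ltn 0%N) rs ->
  0 <= posterior_mean alpha theta M rs <= log_moment_cap rs.
Proof.
move=> k0 rs0; have m0 := posterior_mass_gt0 k0 rs0.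
have cap x := @log_moment_capP M rs x.
have c1 : 1 - alpha <= 1 - alpha <= posterior_mass rs + 1 by case/andP: halpha; move: m0; lra.
rewrite posterior_meanE divr_ge0 ?(ltW m0)//=; last first.
  apply: predictive_sum_ge0 => // [|r rrs]; first by case/andP: (cap _ c1).
  by case/andP: (cap _ (class_parameter_range rrs rs0)).
rewrite ler_pdivrMr// mulrC; apply: predictive_sum_le => // [|r rrs].
  by case/andP: (cap _ c1).
by case/andP: (cap _ (class_parameter_range rrs rs0)).
Qed.

(** Each partial sum changes by at most [1 / s], and the weights add up to [s]. *)
Lemma predictive_sum_rescale M rs : (0 < size rs)%N -> all (ltn 0%N) rs ->
  0 <= predictive_sum (fun x => log_moment x (posterior_mass rs + 1) M) rs -
       predictive_sum (fun x => log_moment x (posterior_mass rs) M) rs <= 1.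
Proof.
move=> k0 rs0; set s := posterior_mass rs; have s0 : 0 < s := posterior_mass_gt0 k0 rs0.
rewrite -predictive_sumB.
have G x : 1 - alpha <= x <= s + 1 ->
    0 <= log_moment x (s + 1) M - log_moment x s M <= s^-1.
  move=> /andP[ax xs]; rewrite log_moment_shift_scale//.
  have x0 : 0 <= x by apply: le_trans ax; case/andP: halpha; lra.
  have s1 : 0 < s + 1 by rewrite addr_gt0.
  rewrite divr_ge0 ?subr_ge0 ?beta_ratio_tail_le1 ?(ltW s0)//=.
  by rewrite ler_piMl ?invr_ge0 ?(ltW s0)// gerBl beta_ratio_tail_ge0.
have c1 : 1 - alpha <= 1 - alpha <= s + 1 by case/andP: halpha; move: s0; lra.
rewrite predictive_sum_ge0//=; last 2 first.
- by case/andP: (G _ c1).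
- by move=> r rrs; case/andP: (G _ (class_parameter_range rrs rs0)).
rewrite -[leRHS](divff (lt0r_neq0 s0)); apply: predictive_sum_le => //.
- by case/andP: (G _ c1).
- by move=> r rrs; case/andP: (G _ (class_parameter_range rrs rs0)).
Qed.

(** Here [e] is the change of the mixture due to the weights and classes alone, at the
old scale.  Changing the scale adds at most one, and the change of normalization
subtracts at most the old mean; both [e] and that mean are at most linear in [n], and
the division by [theta + n + 1] leaves a bounded quantity. *)
Lemma posterior_mean_increment_gen M rs rs' e : (0 < size rs)%N ->
  all (ltn 0%N) rs -> (0 < size rs')%N -> all (ltn 0%N) rs' ->
  sumn rs' = (sumn rs).+1 -> -1 <= e <= log_moment_cap rs ->
  predictive_sum (fun x => log_moment x (posterior_mass rs + 1) M) rs' =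
  predictive_sum (fun x => log_moment x (posterior_mass rs + 1) M) rs + e ->
  `|posterior_mean alpha theta M rs' - posterior_mean alpha theta M rs| <=
  2 / (1 - alpha) + 1.
Proof.
move=> k0 rs0 k0' rs0' sE /andP[e1 e2] E.
have m0 := posterior_mass_gt0 k0 rs0.
have mE : posterior_mass rs' = posterior_mass rs + 1 by rewrite /posterior_mass sE -natr1 addrA.
have /andP[Z0 ZL] := posterior_mean_bounds M k0 rs0.
have /andP[d0 d1] := predictive_sum_rescale M k0' rs0'.
rewrite mE E in d0 d1.
have A : predictive_sum (fun x => log_moment x (posterior_mass rs + 1) M) rs =
    posterior_mean alpha theta M rs * posterior_mass rs.
  by rewrite posterior_meanE mulfVK// gt_eqF.
rewrite A in d0 d1.
have m1 : 0 < posterior_mass rs + 1 by rewrite addr_gt0.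
rewrite [X in X - _]posterior_meanE mE.
set B := predictive_sum _ rs' in d0 d1 *; set Z := posterior_mean _ _ _ _ in Z0 ZL d0 d1 *.
have -> : B / (posterior_mass rs + 1) - Z = (B - Z * posterior_mass rs - Z) / (posterior_mass rs + 1).
  by field; rewrite gt_eqF.
rewrite normrM normfV (gtr0_norm m1) ler_pdivrMr//.
have /andP[a0 a1] := halpha.
have capE : log_moment_cap rs + 1 <= (2 / (1 - alpha) + 1) * (posterior_mass rs + 1).
  rewrite mulrDl mul1r lerD//; last by move: m0; lra.
  rewrite /log_moment_cap mulrAC ler_pM2r ?invr_gt0 ?subr_gt0//.
  have m2 : 1 <= posterior_mass rs + 1 by move: m0; lra.
  by lra.
apply: le_trans capE; rewrite ler_norml; apply/andP; split; lra.
Qed.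

Lemma posterior_mean_increment M rs rs' : (0 < size rs)%N -> all (ltn 0%N) rs ->
  rs' = rcons rs 1%N \/ (exists2 j, (j < size rs)%N & rs' = incr_nth rs j) ->
  `|posterior_mean alpha theta M rs' - posterior_mean alpha theta M rs| <=
  2 / (1 - alpha) + 1.
Proof.
move=> k0 rs0; have m0 := posterior_mass_gt0 k0 rs0; have /andP[a0 a1] := halpha.
have s0 : 0 < posterior_mass rs + 1 by rewrite addr_gt0.
(* A new class adds [alpha] to the weight of new species, and a class of weight
   [1 - alpha]. *)
case=> [->|[j js ->]].
  apply: (@posterior_mean_increment_gen M rs _ (alpha * log_moment (1 - alpha) (posterior_mass rs + 1) M +
    (1 - alpha) * log_moment (1 - alpha + 1) (posterior_mass rs + 1) M)) => //.
  - by rewrite size_rcons.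
  - by rewrite all_rcons rs0.
  - by rewrite -cats1 sumn_cat/= addn0 addn1.
  - have /andP[g0 g1] : 0 <= log_moment (1 - alpha) (posterior_mass rs + 1) M <= log_moment_cap rs.
      by apply: log_moment_capP; move: m0; lra.
    have /andP[h0 h1] : 0 <= log_moment (1 - alpha + 1) (posterior_mass rs + 1) M <= log_moment_cap rs.
      apply: log_moment_capP; have := sumn_gt0 rs0 k0; rewrite -(ler_nat R) /posterior_mass.
      by move: htheta; lra.
    by apply/andP; split; nra.
  - rewrite /predictive_sum size_rcons big_rcons/= -natr1; ring.
have jsE : rs = take j rs ++ nth 0%N rs j :: drop j.+1 rs.
  by rewrite -drop_nth// cat_take_drop.
have incE : incr_nth rs j = take j rs ++ (nth 0%N rs j).+1 :: drop j.+1 rs.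
  elim: (rs) (j) js => //= r u ih [|i] /= irs; first by rewrite drop0.
  by rewrite ih.
have rin : nth 0%N rs j \in rs by rewrite mem_nth.
have rj0 : (0 < nth 0%N rs j)%N by apply: (allP rs0).
(* If the class [j] grows, its weight [y - 1] becomes [y] and its parameter [y] becomes
   [y + 1]; by [log_moment_shift] the change [y g(y + 1) - (y - 1) g(y)] of its term,
   with [g] the partial sum, is [g(y)] minus a number in [[0, 1]]. *)
pose y : R := (nth 0%N rs j)%:R - alpha + 1.
apply: (@posterior_mean_increment_gen M rs _ (log_moment y (posterior_mass rs + 1) M
   - (1 - beta_ratio_tail y (posterior_mass rs + 1) M))) => //.
- by rewrite size_incr_nth js.
- by move: rs0; rewrite incE {1}jsE !all_cat/= => /and3P[-> _ ->].
- by rewrite incE [in RHS]jsE !sumn_cat/= addSn addnS.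
- have /andP[y1 y2] := class_parameter_range rin rs0.
  have /andP[g0 g1] := @log_moment_capP M rs _ (class_parameter_range rin rs0).
  have q0 : 0 <= beta_ratio_tail y (posterior_mass rs + 1) M by apply: beta_ratio_tail_ge0.
  have q1 : beta_ratio_tail y (posterior_mass rs + 1) M <= 1.
    by apply: beta_ratio_tail_le1 => //; rewrite (le_trans _ y1)// subr_ge0 ltW.
  by rewrite -/y in g0 g1; apply/andP; split; lra.
have y0 : 0 < y.
  have /andP[y1 _] := class_parameter_range rin rs0; apply: lt_le_trans y1; lra.
have qE : 1 - beta_ratio_tail y (posterior_mass rs + 1) M =
    y * (log_moment y (posterior_mass rs + 1) M - log_moment (y + 1) (posterior_mass rs + 1) M).
  by rewrite log_moment_shift// mulrC divfK// gt_eqF.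
pose G x := log_moment x (posterior_mass rs + 1) M.
have sumE : \sum_(r <- rs) (r%:R - alpha) * G (r%:R - alpha + 1) =
    \sum_(r <- take j rs) (r%:R - alpha) * G (r%:R - alpha + 1) +
    ((y - 1) * G y + \sum_(r <- drop j.+1 rs) (r%:R - alpha) * G (r%:R - alpha + 1)).
  by rewrite {1}jsE big_cat big_cons/= /y addrK.
rewrite qE /predictive_sum size_incr_nth js sumE incE big_cat big_cons/= -/(G _).
rewrite (_ : (nth 0%N rs j).+1%:R - alpha = y); last by rewrite -natr1 /y addrAC.
by rewrite -/(G _) -/(G _); ring.
Qed.

End posterior_mean_increment.

(** * The law of the abundance vector *)

Section integral_word_sum.
Context d (T : measurableType d) (R : realType) (mu : {measure set T -> \bar R}).
Local Open Scope ereal_scope.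

Lemma measurable_word_sum n (G : seq nat -> T -> \bar R) :
  (forall c, measurable_fun setT (G c)) -> (forall c t, 0 <= G c t) ->
  measurable_fun setT (fun t => word_sum n (G ^~ t)).
Proof.
elim: n G => [|n ih] G mG G0 /=; first exact: mG.
apply: ge0_emeasurable_sum => [x t _ _|x _]; first exact: word_sum_ge0.
by apply: (ih (fun c => G (x :: c))).
Qed.

Lemma integral_word_sum n (G : seq nat -> T -> \bar R) :
  (forall c, measurable_fun setT (G c)) -> (forall c t, 0 <= G c t) ->
  \int[mu]_t word_sum n (G ^~ t) = word_sum n (fun c => \int[mu]_t G c t).
Proof.
elim: n G => [//|n ih] G mG G0 /=; rewrite integral_nneseries//.
- by apply: eq_eseriesr => x _; rewrite (ih (fun c => G (x :: c))).
- by move=> x; exact: (measurable_word_sum _ (fun c => mG (x :: c))).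
- by move=> x t _; exact: word_sum_ge0.
Qed.

End integral_word_sum.

Section species_sampling.
Context (R : realType) d (T : measurableType d) (PP : probability T R).
Variables (S : {RV PP >-> ranked_simplex R}) (X : nat -> {RV PP >-> R}).
Hypothesis hX : forall l U, measurable U ->
  distribution PP (X l) U = uniform_prob (@ltr01 R) U.
Hypothesis hXindep : mutually_independent X.
Hypothesis hSX : independent_of_sequence S X.
Variable a : nat -> ranked_simplex R -> R.
Hypothesis ha : interval_placement a.
Local Open Scope ereal_scope.

Definition in_interval (l i : nat) : set T := [set t | species_interval a (S t) i (X l t)].

Definition interval_graph (i : nat) : set (ranked_simplex R * R) :=
  [set z | species_interval a z.1 i z.2].

Lemma measurable_interval_graph i : measurable (interval_graph i).
Proof.
have [ma _ _] := ha.
have ma1 : measurable_fun setT (fun z : ranked_simplex R * R => a i z.1).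
  exact: measurableT_comp (ma i) measurable_fst.
have ms1 : measurable_fun setT (fun z : ranked_simplex R * R => z.1 i).
  exact: measurableT_comp (@measurable_mass R i) measurable_fst.
have -> : interval_graph i = [set z | (a i z.1 < z.2)%R] `&`
    [set z | (z.2 < a i z.1 + z.1 i)%R].
  apply/seteqP; split => z /=; rewrite /interval_graph /species_interval/= in_itv/=.
    by move=> /andP[].
  by move=> [-> ->].
have lt_meas (f g : ranked_simplex R * R -> R) : measurable_fun setT f ->
    measurable_fun setT g -> measurable [set z | (f z < g z)%R].
  move=> mf mg; rewrite -[X in measurable X]setTI.
  have := measurable_fun_ltr mf mg measurableT (Y := [set true]) I.
  by rewrite (_ : _ @^-1` [set true] = [set z | (f z < g z)%R]).
apply: measurableI; apply: lt_meas => //.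
exact: measurable_funD.
Qed.

Lemma measurable_in_interval l i : measurable (in_interval l i).
Proof.
have mSX : measurable_fun setT (fun t => (S t, X l t)).
  by apply: measurable_fun_pair; exact: measurable_funP.
have := mSX measurableT _ (measurable_interval_graph i).
by rewrite setTI.
Qed.

Lemma uniform_species_interval l s i :
  distribution PP (X l) (species_interval a s i) = (s i)%:E.
Proof.
have [_ sub _] := ha.
rewrite hX; last exact: measurable_itv.
rewrite /uniform_prob; transitivity
  (\int[@lebesgue_measure R]_(x in species_interval a s i) (cst 1 x)).
  apply: eq_integral => x; rewrite inE => /sub; rewrite /= in_itv/= /uniform_pdf => ->.
  by rewrite subr0 invr1.
rewrite integral_cst//= ?mul1e; last exact: measurable_itv.
rewrite lebesgue_measure_itv/= lte_fin ltrDl.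
case: ifPn => [_|]; first by rewrite -EFinD addrAC subrr add0r.
rewrite -leNgt => s0; congr (_%:E); apply/eqP.
by rewrite eq_le s0 mass_ge0.
Qed.

(** The first individuals fall into the prescribed random intervals and the others into
prescribed fixed sets; the fixed sets are traded for intervals one by one. *)
Definition mixed_event (c : seq nat) (A : nat -> set R) (n : nat) : set T :=
  \bigcap_(l in `I_n) (if (l < size c)%N then in_interval l (nth 0%N c l)
                       else X l @^-1` A l).

Lemma measurable_mixed_event c A n : (forall l, measurable (A l)) ->
  measurable (mixed_event c A n).
Proof.
move=> mA; apply: bigcap_measurableType => l _; case: ifP => _.
  exact: measurable_in_interval.
exact: measurable_RV_preimage.
Qed.

Lemma measurable_comp_S (phi : ranked_simplex R -> \bar R) :
  measurable_fun setT phi -> measurable_fun setT (phi \o S).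
Proof. by move=> mphi; exact: measurableT_comp mphi (measurable_funP S). Qed.

Lemma integral_rectangle (phi : ranked_simplex R -> \bar R) A n :
  measurable_fun setT phi -> (forall s, 0 <= phi s) ->
  (forall l, measurable (A l)) ->
  \int[PP]_(t in mixed_event [::] A n) phi (S t) =
  (\prod_(0 <= l < n) PP (X l @^-1` A l)) * \int[PP]_t phi (S t).
Proof.
move=> mphi phi0 mA; set E := mixed_event _ _ _.
have mE : measurable E by exact: measurable_mixed_event.
pose J := [fset l | l in iota 0 n]%fset.
have JE l : (l \in J) = (l < n)%N by rewrite in_fset/= mem_iota.
have EE : E = \bigcap_(j in [set` J]) (X j @^-1` A j).
  by apply/seteqP; split => t tE l /=; rewrite ?JE => ln; apply: tE; rewrite /= ?JE.
have PE : PP E = \prod_(0 <= l < n) PP (X l @^-1` A l).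
  rewrite EE (hXindep J mA) /index_iota subn0; apply: perm_big.
  apply: uniq_perm; rewrite ?iota_uniq ?fset_uniq// => l.
  by rewrite JE mem_iota add0n.
have := @ge0_integral_independent_pair _ T R PP _ unit _ _ (fun=> tt) S
  (measurable_cst _) (measurable_funP S) E mE (distribution PP S) _
  (fun z => phi z.2).
move=> ->//.
- rewrite -(ge0_integral_distribution S mphi phi0)/= -PE.
  by rewrite integral_cst//= muleC.
- move=> U B mU mB; have [Ut|Ut] := pselect (U tt).
    rewrite (_ : (fun=> tt) @^-1` U = setT) ?setTI.
      by rewrite EE hSX// muleC.
    by apply/seteqP; split.
  rewrite (_ : (fun=> tt) @^-1` U = set0) ?set0I ?measure0 ?mul0e//.
  by apply/seteqP; split.
- exact: measurableT_comp mphi measurable_snd.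
Qed.

(** Induction on the number of random intervals.  With indicator functions of [S], the
induction hypothesis says exactly that [S] and the next individual [X m] are
independent on the event where the earlier ones fall into their intervals, so that
[X m] can be integrated out; it falls into the [x]-th interval with probability
[S x]. *)
Lemma integral_mixed_event (phi : ranked_simplex R -> \bar R) c A n :
  (size c <= n)%N ->
  measurable_fun setT phi -> (forall s, 0 <= phi s) ->
  (forall l, measurable (A l)) ->
  \int[PP]_(t in mixed_event c A n) phi (S t) =
  (\prod_(size c <= l < n) PP (X l @^-1` A l)) *
  \int[PP]_t (phi (S t) * (\prod_(x <- c) S t x)%:E).
Proof.
elim/last_ind: c phi A => [|c x ih] phi A.
  move=> _ mphi phi0 mA; rewrite integral_rectangle//; congr (_ * _).
  by apply: eq_integral => t _; rewrite big_nil mule1.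
rewrite size_rcons => cn mphi phi0 mA.
set m := size c in cn *.
(* The next individual is constrained to [B], to test its independence. *)
pose A' B l := if l == m then B else A l.
have mA' B : measurable B -> forall l, measurable (A' B l).
  by move=> mB l; rewrite /A'; case: eqP.
pose E := mixed_event c (A' setT) n.
have mE : measurable E by apply: measurable_mixed_event; exact: mA'.
have prodE B : \prod_(m <= l < n) PP (X l @^-1` A' B l) =
    PP (X m @^-1` B) * \prod_(m.+1 <= l < n) PP (X l @^-1` A l).
  rewrite big_ltn// {1}/A' eqxx; congr (_ * _).
  apply: eq_big_nat => l /andP[ml _]; rewrite /A' gtn_eqF//.
have EB B : mixed_event c (A' B) n = X m @^-1` B `&` E.
  apply/seteqP; split => [t tE|t [tB tE] l ln].
    split; first by have := tE m cn; rewrite /= ltnn /A' eqxx.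
    move=> l ln; have := tE l ln; rewrite /=; case: ifP => // _.
    by rewrite /A'; case: eqP.
  have := tE l ln; rewrite /=; case: ifP => // _.
  by rewrite /A'; case: eqP => [->|].
have -> : mixed_event (rcons c x) A n = E `&` in_interval m x.
  apply/seteqP; split => [t tE|t [tE tI] l ln].
    split; last first.
      by have := tE m cn; rewrite /= size_rcons ltnSn nth_rcons ltnn eqxx.
    move=> l ln; have := tE l ln; rewrite /= size_rcons ltnS nth_rcons /A' -/m.
    by case: ltngtP.
  have := tE l ln; rewrite /= size_rcons ltnS nth_rcons /A' -/m.
  by case: ltngtP => // ->.
rewrite integral_mkcondr.
pose h (z : ranked_simplex R * R) := phi z.1 * (\1_(interval_graph x) z : R)%:E.
have mh : measurable_fun setT h.
  apply: emeasurable_funM; first exact: measurableT_comp mphi measurable_fst.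
  by apply/measurable_EFinP/measurable_indic; exact: measurable_interval_graph.
have h0 z : 0 <= h z by rewrite mule_ge0// lee_fin.
transitivity (\int[PP]_(t in E) h (S t, X m t)).
  apply: eq_integral => t _; rewrite patchE /h indicE.
  rewrite (_ : ((S t, X m t) \in interval_graph x) = (t \in in_interval m x)).
    by case: ifP => _; rewrite ?mule1 ?mule0.
  by apply/idP/idP; rewrite !inE.
rewrite (@ge0_integral_independent_pair _ T R PP _ _ _ _ S (X m)
  (measurable_funP _) (measurable_funP _) E mE (distribution PP (X m)))//; last first.
  move=> B C mB mC.
  have indE (F : set T) : measurable F -> PP (S @^-1` B `&` F) =
      \int[PP]_(t in F) (\1_B (S t))%:E.
    move=> mF; rewrite -[RHS]/(\int[PP]_(t in F) (\1_(S @^-1` B) t)%:E).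
    rewrite integral_indic//.
    by rewrite -[X in measurable X]setTI; exact: measurable_funP.
  have IH := ih (fun s => (\1_B s)%:E) _ (ltnW cn) _ _ (mA' _ _).
  rewrite -setIA -EB !indE//; last by apply: measurable_mixed_event; exact: mA'.
  rewrite !IH//; do ?[exact/measurable_EFinP/measurable_indic
                    |by move=> s; rewrite lee_fin].
  by rewrite !prodE preimage_setT probability_setT mul1e -muleA muleC.
transitivity (\int[PP]_(t in E) (phi (S t) * (S t x)%:E)).
  apply: eq_integral => t _.
  have indE y : \1_(interval_graph x) (S t, y) = \1_(species_interval a (S t) x) y :> R.
    by rewrite !indicE; congr (_%:R); apply/idP/idP; rewrite !inE.
  under eq_integral do rewrite /h/= indE.
  rewrite ge0_integralZl//; last first.
    by apply/measurable_EFinP/measurable_indic; exact: measurable_itv.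
  rewrite integral_indic ?setIT; [|exact: measurableT|exact: measurable_itv].
  by rewrite -(uniform_species_interval m (S t) x).
rewrite (ih (fun s => phi s * (s x)%:E)) ?prodE//.
- rewrite preimage_setT probability_setT mul1e; congr (_ * _).
  by apply: eq_integral => t _; rewrite big_rcons/= -muleA -EFinM mulrC.
- exact: ltnW.
- by apply: emeasurable_funM => //; apply/measurable_EFinP; exact: measurable_mass.
- by move=> s; rewrite mule_ge0// lee_fin mass_ge0.
- exact: mA'.
Qed.

(** The individuals fall into the intervals listed in the word [c]. *)
Definition color_event (c : seq nat) : set T := mixed_event c (fun=> setT) (size c).

Lemma measurable_color_event c : measurable (color_event c).
Proof. by apply: measurable_mixed_event. Qed.

Lemma integral_color_event (phi : ranked_simplex R -> \bar R) c :
  measurable_fun setT phi -> (forall s, 0 <= phi s) ->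
  \int[PP]_(t in color_event c) phi (S t) =
  \int[PP]_t (phi (S t) * (\prod_(x <- c) S t x)%:E).
Proof. by move=> mphi phi0; rewrite integral_mixed_event// big_geq// mul1e. Qed.

Lemma color_event_rcons c x :
  color_event (rcons c x) = color_event c `&` in_interval (size c) x.
Proof.
apply/seteqP; split => [t tE|t [tE tI] l].
  split; last first.
    by have := tE (size c); rewrite /= size_rcons ltnSn nth_rcons ltnn eqxx; exact.
  move=> l /= lc; have := tE l; rewrite /= size_rcons ltnS (ltnW lc) nth_rcons lc.
  exact.
rewrite /= size_rcons ltnS nth_rcons => lc; rewrite lc.
move: lc; rewrite leq_eqVlt => /orP[/eqP ->|lc]; first by rewrite ltnn eqxx.
by rewrite lc; have := tE l; rewrite /= lc; exact.
Qed.

Lemma trivIset_in_interval l : trivIset setT (in_interval l).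
Proof.
have [_ _ triv] := ha.
apply/trivIsetP => i j _ _ ij; apply/seteqP; split => // t [ti tj].
have /trivIsetP/(_ i j I I ij) := triv (S t); rewrite -subset0 => /(_ (X l t)).
by apply.
Qed.

Lemma prob_in_interval l x : PP (in_interval l x) = \int[PP]_t (S t x)%:E.
Proof.
have mI := measurable_interval_graph x.
have indE t y : \1_(interval_graph x) (S t, y) = \1_(species_interval a (S t) x) y :> R.
  by rewrite !indicE; congr (_%:R); apply/idP/idP; rewrite !inE.
transitivity (\int[PP]_(t in setT) ((\1_(interval_graph x) (S t, X l t) : R)%:E)).
  rewrite (_ : (fun t => _) = (fun t => (\1_(in_interval l x) t : R)%:E)).
    by rewrite integral_indic ?setIT//; exact: measurable_in_interval.
  apply/funext => t; rewrite indE !indicE.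
  have -> : (X l t \in species_interval a (S t) x) = (t \in in_interval l x).
    by apply/idP/idP; rewrite !inE.
  by [].
rewrite (@ge0_integral_independent_pair _ T R PP _ _ _ _ S (X l)
  (measurable_funP _) (measurable_funP _) setT measurableT (distribution PP (X l)) _
  (fun z => (\1_(interval_graph x) z : R)%:E))//.
- apply: eq_integral => t _; under eq_integral do rewrite indE.
  rewrite integral_indic ?setIT; [|exact: measurableT|exact: measurable_itv].
  by rewrite -(uniform_species_interval l (S t) x).
- move=> B C mB mC; rewrite !setIT.
  have := @hSX B [fset l]%fset (fun=> C) mB (fun=> mC).
  rewrite (_ : \bigcap_(j in [set` [fset l]%fset]) (X j @^-1` C) = X l @^-1` C)//.
  apply/seteqP; split => [t tA|t tC j]; first by apply: tA; rewrite /= inE.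
  by rewrite /= inE => /eqP ->.
- by apply/measurable_EFinP/measurable_indic.
Qed.

(** The lengths of the intervals add up to one. *)
Lemma prob_no_interval l : PP (~` \bigcup_x in_interval l x) = 0.
Proof.
have mI x := measurable_in_interval l x.
have mU : measurable (\bigcup_x in_interval l x) by exact: bigcupT_measurable.
suff pU : PP (\bigcup_x in_interval l x) = 1 by rewrite probability_setC// pU subee.
transitivity (\sum_(0 <= x <oo) PP (in_interval l x)).
  by apply: measure_semi_bigcup => //; exact: trivIset_in_interval.
under eq_eseriesr do rewrite prob_in_interval.
rewrite -integral_nneseries//; last 2 first.
- move=> x; apply/measurable_EFinP.
  exact: measurableT_comp (@measurable_mass R x) (measurable_funP S).
- by move=> x t _; rewrite lee_fin mass_ge0.
under eq_integral do rewrite mass_sum.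
by rewrite integral_cst//= probability_setT mule1.
Qed.

Lemma integral_split_interval l (E : set T) (f : T -> \bar R) : measurable E ->
  measurable_fun setT f -> (forall t, 0 <= f t) ->
  \int[PP]_(t in E) f t =
  \sum_(0 <= x <oo) \int[PP]_(t in E `&` in_interval l x) f t.
Proof.
move=> mE mf f0.
have mI x := measurable_in_interval l x.
have mU : measurable (\bigcup_x in_interval l x) by exact: bigcupT_measurable.
rewrite (@ge0_negligible_integral _ T R PP E (~` \bigcup_x in_interval l x))//; last 3 first.
- exact: measurableC.
- exact: measurable_funTS.
- exact: prob_no_interval.
rewrite setDE setCK setI_bigcupr ge0_integral_bigcup//.
- by move=> x; exact: measurableI.
- exact: measurable_funTS.
- by apply: trivIset_setIl; exact: trivIset_in_interval.
Qed.

Lemma integral_word_split n (E : set T) (f : T -> \bar R) : measurable E ->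
  measurable_fun setT f -> (forall t, 0 <= f t) ->
  \int[PP]_(t in E) f t =
  word_sum n (fun c => \int[PP]_(t in E `&` color_event c) f t).
Proof.
move=> mE mf f0; elim: n => [|n ih].
  rewrite /= (_ : color_event [::] = setT) ?setIT//.
  by apply/seteqP; split => // t _ l.
rewrite ih word_sum_rcons; apply: eq_word_sum => c cn.
rewrite (@integral_split_interval (size c))//; last first.
  by apply: measurableI => //; exact: measurable_color_event.
by apply: eq_eseriesr => x _; rewrite color_event_rcons setIA.
Qed.

Definition abundance_event n (r : seq nat) : set T :=
  [set t | abundance (same_species a (S t) (fun l => X l t)) n = r].

Lemma eq_abundance (e e' : rel nat) n :
  (forall l m, (l < n)%N -> (m < n)%N -> e l m = e' l m) ->
  abundance e n = abundance e' n.
Proof.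
move=> ee'; rewrite /abundance.
have -> : [seq l <- iota 0 n | ~~ has (fun m => e m l) (iota 0 l)] =
    [seq l <- iota 0 n | ~~ has (fun m => e' m l) (iota 0 l)].
  apply: eq_in_filter => l; rewrite mem_iota add0n/= => ln; congr (~~ _).
  apply: eq_in_has => m; rewrite mem_iota add0n/= => ml.
  by rewrite ee'// (ltn_trans ml).
apply/eq_in_map => l; rewrite mem_filter mem_iota add0n/= => /andP[_ ln].
by apply: eq_in_count => m; rewrite mem_iota add0n/= => mn; rewrite ee'.
Qed.

Lemma same_species_color c t l m : color_event c t ->
  (l < size c)%N -> (m < size c)%N ->
  same_species a (S t) (fun l => X l t) l m = (nth 0%N c l == nth 0%N c m).
Proof.
move=> tc lc mc; have [_ _ triv] := ha.
have tI k : (k < size c)%N -> species_interval a (S t) (nth 0%N c k) (X k t).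
  by move=> kc; have := tc k; rewrite /= kc; exact.
have inj k i : (k < size c)%N -> species_interval a (S t) i (X k t) -> nth 0%N c k = i.
  move=> kc ki; apply/eqP/negPn/negP => ne.
  have /trivIsetP/(_ _ _ I I ne) := triv (S t); rewrite -subset0 => /(_ (X k t)).
  by apply; split => //; exact: tI.
rewrite /same_species; apply/idP/idP.
  move=> /orP[/eqP -> //|/asboolP[i [li mi]]].
  by rewrite (inj l i)// (inj m i).
move=> /eqP cE; apply/orP; right; apply/asboolP; exists (nth 0%N c l).
by split; [exact: tI|rewrite cE; exact: tI].
Qed.

Lemma abundance_color c t : color_event c t ->
  abundance (same_species a (S t) (fun l => X l t)) (size c) = species_counts c.
Proof.
move=> tc; rewrite -abundance_species_counts; apply: eq_abundance => l m lc mc.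
exact: same_species_color.
Qed.

Lemma measurable_same_species l m :
  measurable [set t | same_species a (S t) (fun l => X l t) l m].
Proof.
rewrite /same_species; have [_|lm] := eqVneq l m.
  by rewrite (_ : [set t | _] = setT)//; apply/seteqP; split.
rewrite (_ : [set t | _] = \bigcup_i (in_interval l i `&` in_interval m i)).
  by apply: bigcupT_measurable => i; apply: measurableI; exact: measurable_in_interval.
apply/seteqP; split => [t /asboolP[i [li mi]]|t [i _ [li mi]]]; first by exists i.
by apply/asboolP; exists i.
Qed.

(** The vector depends only on which of the finitely many pairs of individuals are of
the same species. *)
Lemma measurable_abundance_event n r : measurable (abundance_event n r).
Proof.
(* The relation whose restriction to the first [n] individuals is [b]. *)
pose e (b : {set 'I_n * 'I_n}) : rel nat := fun l m =>
  [exists i : 'I_n, [exists j : 'I_n, [&& val i == l, val j == m & (i, j) \in b]]].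
have eE b (i j : 'I_n) : e b i j = ((i, j) \in b).
  apply/existsP/idP => [[i' /existsP[j' /and3P[/eqP/val_inj -> /eqP/val_inj ->]]]//|ij].
  by exists i; apply/existsP; exists j; rewrite !eqxx.
pose B (b : {set 'I_n * 'I_n}) : set T := \bigcap_(z in [set: 'I_n * 'I_n])
  [set t | same_species a (S t) (fun l => X l t) z.1 z.2 = (z \in b)].
have -> : abundance_event n r = \bigcup_(b in [set b | abundance (e b) n == r]) B b.
  apply/seteqP; split => [t tr|t [b /eqP br tb]].
    pose b : {set 'I_n * 'I_n} :=
      finset (fun z : 'I_n * 'I_n => same_species a (S t) (fun l => X l t) z.1 z.2).
    exists b; last by move=> z _; rewrite /= inE.
    apply/eqP; rewrite -tr; apply: eq_abundance => l m ln mn.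
    by rewrite -[l]/(val (Ordinal ln)) -[m]/(val (Ordinal mn)) eE inE.
  rewrite /abundance_event/= -br; apply: eq_abundance => l m ln mn.
  by have := tb (Ordinal ln, Ordinal mn) I; rewrite /= => ->; rewrite -eE.
apply: fin_bigcup_measurable; first exact: finite_finset.
move=> b _; apply: fin_bigcap_measurable; first exact: finite_finset.
move=> z _; case: (z \in b); first exact: measurable_same_species.
rewrite (_ : [set t | _] = ~` [set t | same_species a (S t) (fun l => X l t) z.1 z.2]).
  by apply: measurableC; exact: measurable_same_species.
by apply/seteqP; split => t /=; [move=> ->|move/negP/negbTE].
Qed.

(** Condition on the word of species of the first [n] individuals: given [S], it has
probability the product of the masses, and only words with counts [r] contribute. *)
Lemma integral_abundance_event n r (phi : ranked_simplex R -> \bar R) :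
  all (ltn 0%N) r -> measurable_fun setT phi -> (forall s, 0 <= phi s) ->
  (forall s, phi s \is a fin_num) ->
  \int[PP]_(t in abundance_event n r) phi (S t) =
  (word_count n r)%:R%:E * \int[PP]_t (phi (S t) * distinct_sum (powers r) (S t)).
Proof.
move=> r0 mphi phi0 phifin.
have mphiS := measurable_comp_S mphi.
have mmass x : measurable_fun setT (fun t => S t x).
  exact: measurableT_comp (@measurable_mass R x) (measurable_funP S).
rewrite (@integral_word_split n)//; last exact: measurable_abundance_event.
pose G c t := phi (S t) * (\prod_(x <- c) S t x * (species_counts c == r)%:R)%:E.
have prod0 c t : (0 <= \prod_(x <- c) S t x)%R.
  by apply: prodr_ge0 => x _; exact: mass_ge0.
have G0 c t : 0 <= G c t by rewrite mule_ge0// lee_fin mulr_ge0.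
have mG c : measurable_fun setT (G c).
  apply: emeasurable_funM => //; apply/measurable_EFinP.
  by apply: measurable_funM => //; apply: measurable_prod.
transitivity (word_sum n (fun c => \int[PP]_t G c t)).
  apply: eq_word_sum => c cn; have [cr|cr] := eqVneq (species_counts c) r.
    rewrite (_ : _ `&` _ = color_event c); last first.
      apply/seteqP; split => [t []//|t tc]; split => //.
      by rewrite /abundance_event/= -cn abundance_color.
    rewrite integral_color_event//; apply: eq_integral => t _.
    by rewrite /G cr eqxx mulr1.
  rewrite (_ : _ `&` _ = set0).
    rewrite integral_set0 integral0_eq// => t _.
    by rewrite /G (negbTE cr) mulr0 mule0.
  apply/seteqP; split => // t [tr tc]; case/eqP: cr.
  by rewrite -(abundance_color tc) cn.
rewrite -integral_word_sum// -ge0_integralZl//; last 2 first.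
- apply: emeasurable_funM => //.
  by apply: (@measurable_distinct_sum _ _ T).
- by move=> t _; rewrite mule_ge0 ?distinct_sum_ge0.
apply: eq_integral => t _; rewrite /G -(fineK (phifin (S t))).
rewrite word_sumZl; last by move=> c; rewrite lee_fin mulr_ge0.
rewrite muleCA; congr (_ * _).
have := @word_sum_abundance R (S t) (@mass_ge0 R (S t)) n r (fun=> 1) (fun=> lee01).
rewrite -(word_sum_distinct_sum (@mass_ge0 R (S t)) r0) => H.
transitivity (word_sum n (fun c => (\prod_(x <- c) S t x * (species_counts c == r)%:R)%:E * 1)).
  by apply: eq_word_sum => c _; rewrite mule1.
rewrite H; congr (_ * _); apply: eq_word_sum => c _; exact: mule1.
Qed.

End species_sampling.

(** * The entropy as a limit of truncations *)

Section log_series.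
Variable R : realType.

Definition log_series (M : nat) (y : R) : R := \sum_(i < M) y ^+ i.+1 / i.+1%:R.

Lemma is_derive_ln_compl (y : R) : y < 1 ->
  is_derive y 1 (fun y : R => ln (1 - y)) (- (1 - y)^-1).
Proof.
move=> y1.
have H : is_derive (1 - y) 1 (@ln R) (1 - y)^-1.
  by apply: is_derive1_ln; rewrite subr_gt0.
have H2 : is_derive y 1 (fun y : R => 1 - y) (-1).
  have := @is_deriveB _ _ _ (cst 1 : R -> R) (@idfun R) y 1 _ _
    (is_derive_cst _ _ _) (is_derive_id _ _).
  by rewrite sub0r.
have := @is_derive1_comp _ (@ln R) (fun y : R => 1 - y) y _ _ H H2.
by rewrite mulrN1.
Qed.

(** The derivative is the remainder of a geometric series. *)
Lemma is_derive_log_remainder M (y : R) : y < 1 ->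
  is_derive y 1 (fun y : R => - ln (1 - y) - log_series M y) (y ^+ M / (1 - y)).
Proof.
move=> y1; have ny : 1 - y != 0 by rewrite gt_eqF// subr_gt0.
elim: M => [|M ih].
  have := is_deriveN (is_derive_ln_compl y1); rewrite opprK expr0 mul1r.
  congr (is_derive _ _ _ _); apply/funext => z.
  by rewrite /log_series big_ord0 subr0.
have dX : is_derive y 1 (fun y : R => M.+1%:R^-1 * y ^+ M.+1) (y ^+ M).
  have dE : is_derive y 1 (fun y : R => y ^+ M.+1) (M.+1%:R * y ^+ M).
    apply: DeriveDef; first exact: exprn_derivable.
    by rewrite exp_derive [LHS]mulr1.
  have := @is_deriveZ _ _ _ (fun y : R => y ^+ M.+1) M.+1%:R^-1 y 1 _ dE.
  by rewrite -[_ *: _]/(M.+1%:R^-1 * (M.+1%:R * y ^+ M)) mulrA mulVf ?mul1r.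
have := is_deriveB ih dX.
have -> : y ^+ M / (1 - y) - y ^+ M = y ^+ M.+1 / (1 - y).
  by rewrite exprS; field.
congr (is_derive _ _ _ _); apply/funext => z.
by rewrite /log_series big_ord_recr/= opprD addrA [X in _ = _ - X]mulrC.
Qed.

(** Mean value theorem for the remainder, with its derivative bounded at the right
end of the interval. *)
Lemma log_series_bounds M (y : R) : 0 <= y < 1 ->
  0 <= - ln (1 - y) - log_series M y <= y ^+ M * (y / (1 - y)).
Proof.
move=> /andP[]; rewrite le_eqVlt => /orP[/eqP <- _|y0 y1].
  rewrite subr0 ln1 oppr0 mul0r mulr0 /log_series big1 ?subrr ?lexx// => i _.
  by rewrite expr0n mul0r.
pose F y : R := - ln (1 - y) - log_series M y.
have F0 : F 0 = 0.
  rewrite /F subr0 ln1 oppr0 /log_series big1 ?subrr// => i _.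
  by rewrite expr0n mul0r.
have dF (z : R) : z < 1 -> is_derive z 1 F (z ^+ M / (1 - z)).
  exact: is_derive_log_remainder.
have lt1 (z : R) : z \in `[0, y] -> z < 1.
  by rewrite in_itv/= => /andP[_ zy]; exact: le_lt_trans y1.
have [||c cy] := @MVT R F (fun z => z ^+ M / (1 - z)) 0 y y0.
- by move=> z zy; apply: dF; apply: lt1; exact: subset_itv_oo_cc zy.
- by apply: derivable_within_continuous => z /lt1 z1; exact: (@ex_derive _ _ _ _ _ _ _ (dF z z1)).
move: cy; rewrite in_itv/= => /andP[c0 cy].
rewrite F0 !subr0 -/(F y) => ->.
have c1 : 0 < 1 - c by rewrite subr_gt0 (lt_trans cy).
rewrite mulr_ge0 ?divr_ge0 ?exprn_ge0 ?(ltW c0) ?(ltW c1) ?(ltW y0)//=.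
rewrite -mulrA [_^-1 * y]mulrC ler_pM ?exprn_ge0 ?divr_ge0 ?(ltW c0) ?(ltW c1) ?(ltW y0)//.
  by rewrite lerXn2r ?nnegrE ?(ltW c0) ?(ltW y0) ?(ltW cy).
have y1' : 0 < 1 - y by rewrite subr_gt0.
rewrite ler_pM2l// lef_pV2 ?posrE//.
by rewrite lerD2l lerN2 ltW.
Qed.

Lemma cvg_log_series (y : R) : 0 <= y < 1 ->
  log_series M y @[M --> \oo] --> - ln (1 - y).
Proof.
move=> y01; have /andP[y0 y1] := y01.
have H : (- ln (1 - y) - log_series M y) @[M --> \oo] --> (0 : R).
  apply: (@squeeze_cvgr _ _ _ _ (cst 0) (fun M => y ^+ M * (y / (1 - y)))).
  - by apply: nearW => M; exact: log_series_bounds.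
  - exact: cvg_cst.
  - rewrite -[X in _ --> X](mul0r (y / (1 - y))).
    apply: cvgM; last exact: cvg_cst.
    by apply: cvg_expr; rewrite ger0_norm.
have := cvgB (cvg_cst (- ln (1 - y))) H; rewrite subr0 => H'.
refine (cvg_trans _ (H' _ _)); apply: near_eq_cvg; apply: nearW => M /=.
exact: subKr.
Qed.

Local Open Scope ereal_scope.

(** The logarithmic series at [1 - x]; at [x = 0] both sides are zero by convention. *)
Lemma nneseries_log (x : R) : (0 <= x <= 1)%R ->
  \sum_(0 <= i <oo) ((i.+1%:R^-1)%:E * (slot (1, i.+1)%N x)%:E) = (- (x * ln x))%:E.
Proof.
move=> /andP[x0 x1].
have slotE i : (i.+1%:R^-1)%:E * (slot (1, i.+1)%N x)%:E =
    (x * ((1 - x) ^+ i.+1 / i.+1%:R))%:E.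
  rewrite -EFinM /slot/= expr1 ger0_norm// ger0_norm ?subr_ge0//.
  by congr (_%:E); ring.
under eq_eseriesr do rewrite slotE.
move: x0; rewrite le_eqVlt => /orP[/eqP <-|x0].
  by rewrite mul0r oppr0 eseries0// => i _ _; rewrite mul0r.
apply/cvg_lim => //.
have y01 : (0 <= 1 - x < 1)%R by rewrite subr_ge0 x1 gtrBl.
have := cvgM (cvg_cst x) (cvg_log_series y01); rewrite subKr mulrN => H.
apply: cvg_EFin; first by apply: nearW => n; rewrite sumEFin.
refine (cvg_trans _ (H _ _)); apply: near_eq_cvg; apply: nearW => M /=.
rewrite sumEFin/= /log_series mulr_sumr big_mkord; exact: erefl.
Qed.

(** All terms are nonnegative, so the sums over species and over powers can be
exchanged. *)
Lemma shannon_entropyE (s : ranked_simplex R) :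
  shannon_entropy s = limn (fun M => truncated_entropy M s).
Proof.
have ge0 i x : 0 <= (i.+1%:R^-1)%:E * (slot (1, i.+1)%N (s x))%:E.
  by rewrite mule_ge0 ?lee_fin ?invr_ge0 ?slot_ge0.
transitivity (\sum_(0 <= x <oo) (- (s x * ln (s x)))%:E).
  rewrite /shannon_entropy -limeN.
    by apply: congr_lim; apply/funext => n /=; rewrite -sumeN.
  apply: is_cvg_npeseries => x _ _; rewrite lee_fin mulr_ge0_le0 ?mass_ge0//.
  by rewrite ln_le0// distribution_like_le1//; exact: mass_distribution_like.
under eq_eseriesr => x _.
  rewrite -nneseries_log; last first.
    by rewrite mass_ge0 distribution_like_le1//; exact: mass_distribution_like.
  over.
rewrite (nneseries_interchange _ _ (fun x i => ge0 i x)).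
apply: congr_lim; apply/funext => M; rewrite /truncated_entropy big_mkord.
apply: eq_bigr => i _; rewrite nneseriesZl// => x _.
by rewrite lee_fin slot_ge0.
Qed.

Lemma nondecreasing_truncated_entropy (p : nat -> R) :
  nondecreasing_seq (fun M => truncated_entropy M p).
Proof.
apply/nondecreasing_seqP => M; rewrite /truncated_entropy big_ord_recr/=.
by rewrite leeDl// mule_ge0 ?slot_sum_ge0// lee_fin invr_ge0.
Qed.

Lemma truncated_entropy_fin_num M (s : ranked_simplex R) :
  truncated_entropy M s \is a fin_num.
Proof.
rewrite ge0_fin_numE ?truncated_entropy_ge0//; apply: lte_sum_pinfty => i _.
rewrite lte_mul_pinfty ?lee_fin ?invr_ge0//.
by rewrite (le_lt_trans (slot_sum_le1 _ (mass_distribution_like s)))// ltry.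
Qed.

End log_series.

(** * The entropy estimate *)

Lemma trajectory_positive (Pi : nat -> seq nat) n : trajectory Pi -> (0 < n)%N ->
  (0 < size (Pi n))%N /\ all (ltn 0%N) (Pi n).
Proof.
move=> [Pi1 PiS]; elim: n => // -[_ _|n ih _]; first by rewrite Pi1.
have [k0 Pi0] := ih isT; have [//|->|[j js ->]] := PiS n.+1.
  by rewrite size_rcons all_rcons Pi0.
rewrite size_incr_nth js; split => //.
apply/(all_nthP 0%N) => i; rewrite size_incr_nth js => ik.
by rewrite nth_incr_nth/= ltn_addl//; exact: (allP Pi0) (mem_nth _ ik).
Qed.

Section entropy_estimate.
Variables (R : realType) (alpha theta : R).
Hypotheses (halpha : 0 <= alpha < 1) (htheta : - alpha < theta).
Variable P : probability (ranked_simplex R) R.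
Hypothesis hP : is_PDP alpha theta P.
Context d (T : measurableType d) (PP : probability T R).
Variables (S : {RV PP >-> ranked_simplex R}) (X : nat -> {RV PP >-> R}).
Hypothesis hS : forall A, measurable A -> distribution PP S A = P A.
Hypothesis hX : forall l U, measurable U ->
  distribution PP (X l) U = uniform_prob (@ltr01 R) U.
Hypothesis hXindep : mutually_independent X.
Hypothesis hSX : independent_of_sequence S X.
Variable a : nat -> ranked_simplex R -> R.
Hypothesis ha : interval_placement a.

Lemma integral_law_S (f : ranked_simplex R -> \bar R) :
  measurable_fun setT f -> (forall s, 0 <= f s)%E ->
  (\int[PP]_t f (S t) = \int[P]_s f s)%E.
Proof.
move=> mf f0; rewrite -[LHS](ge0_integral_distribution S mf f0).
by apply: eq_measure_integral => A mA _; exact: hS.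
Qed.

Lemma integral_abundance_truncated_entropy n r M : (0 < size r)%N -> all (ltn 0%N) r ->
  (\int[PP]_(t in abundance_event S X a n r) truncated_entropy M (S t) =
   ((word_count n r)%:R * eppf theta alpha r * posterior_mean alpha theta M r)%:E)%E.
Proof.
move=> k0 r0; have mM := @measurable_truncated_entropy R M.
rewrite (integral_abundance_event hX hXindep hSX ha n r0 mM); last 2 first.
- by move=> s; exact: truncated_entropy_ge0.
- by move=> s; exact: truncated_entropy_fin_num.
rewrite (@integral_law_S (fun s => truncated_entropy M s * distinct_sum (powers r) s)%E).
- by rewrite (integral_PDP_truncated_entropy halpha htheta hP)// -EFinM mulrA.
- by apply: emeasurable_funM => //; exact: measurable_distinct_sum_mass.
- by move=> s; rewrite mule_ge0 ?truncated_entropy_ge0 ?distinct_sum_ge0.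
Qed.

Lemma prob_abundance_event n r : all (ltn 0%N) r ->
  PP (abundance_event S X a n r) = ((word_count n r)%:R * eppf theta alpha r)%:E.
Proof.
move=> r0; have mA := measurable_abundance_event S X ha n r.
transitivity (\int[PP]_(t in abundance_event S X a n r) (1%:E : \bar R))%E.
  by rewrite integral_cst// mul1e.
have := @integral_abundance_event _ _ _ _ _ _ hX hXindep hSX _ ha n r (fun=> 1%:E).
move=> -> //.
rewrite (@integral_law_S (fun s => 1%:E * distinct_sum (powers r) s)%E).
- by under eq_integral do rewrite mul1e; rewrite (integral_PDP_powers halpha htheta hP).
- by apply: emeasurable_funM => //; exact: measurable_distinct_sum_mass.
- by move=> s; rewrite mul1e distinct_sum_ge0.
Qed.

Lemma cvg_integral_truncated_entropy A : measurable A ->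
  (\int[PP]_(t in A) truncated_entropy M (S t))%E @[M --> \oo] -->
  (\int[PP]_(t in A) shannon_entropy (S t))%E.
Proof.
move=> mA; under eq_integral do rewrite shannon_entropyE.
apply: cvg_monotone_convergence => // [M|M t _|t _ n m nm].
- apply: measurable_funTS.
  exact: measurableT_comp (measurable_truncated_entropy M) (measurable_funP S).
- exact: truncated_entropy_ge0.
- exact: nondecreasing_truncated_entropy.
Qed.

(** The constant [word_count * eppf] is the probability of the conditioning event, which
cancels.  The bound on the truncated means makes the limit finite. *)
Lemma cvg_posterior_mean n Pi : trajectory Pi -> (0 < n)%N ->
  exists2 z : R, entropy_estimate S X a n Pi = z%:E &
    posterior_mean alpha theta M (Pi n) @[M --> \oo] --> z.
Proof.
move=> tPi n0; have [k0 r0] := trajectory_positive tPi n0.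
set c := (word_count n (Pi n))%:R * eppf theta alpha (Pi n).
have c0 : 0 < c.
  by rewrite mulr_gt0 ?eppf_gt0// ltr0n word_count_gt0.
set A := abundance_event S X a n (Pi n).
set I := (\int[PP]_(t in A) shannon_entropy (S t))%E.
have mA : measurable A := measurable_abundance_event S X ha n (Pi n).
have cvgI : (c * posterior_mean alpha theta M (Pi n))%:E @[M --> \oo] --> I.
  have := cvg_integral_truncated_entropy mA.
  by under eq_cvg do rewrite integral_abundance_truncated_entropy//.
have finI : I \is a fin_num.
  have bounds M := posterior_mean_bounds halpha htheta M k0 r0.
  rewrite ge0_fin_numE.
  - apply: (@le_lt_trans _ _ (c * log_moment_cap alpha theta (Pi n))%:E); last exact: ltry.
    apply: (cvge_le _ cvgI); apply: nearW => M.
    by rewrite lee_fin ler_pM2l//; have /andP[] := bounds M.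
  - apply: (cvge_ge _ cvgI); apply: nearW => M.
    by rewrite lee_fin mulr_ge0 ?(ltW c0)//; have /andP[] := bounds M.
exists (c^-1 * fine I).
  rewrite /entropy_estimate /cond_expectation -/A prob_abundance_event// -/c -/I.
  by rewrite [RHS]EFinM fineK.
have cvgR : c * posterior_mean alpha theta M (Pi n) @[M --> \oo] --> fine I.
  by move: cvgI; rewrite -(fineK finI) => /fine_cvg.
have := cvgM (cvg_cst c^-1) cvgR => H.
refine (cvg_trans _ (H _ _)); apply: near_eq_cvg; apply: nearW => M /=.
exact: (mulKf (lt0r_neq0 c0)).
Qed.

(** The bound on the increments of the truncated means is uniform in the truncation. *)
Lemma entropy_estimate_increment n Pi : trajectory Pi -> (0 < n)%N ->
  (`|entropy_estimate S X a n.+1 Pi - entropy_estimate S X a n Pi| <=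
   (2 / (1 - alpha) + 1)%:E)%E.
Proof.
move=> tPi n0; have [k0 r0] := trajectory_positive tPi n0.
have [z -> cvgz] := cvg_posterior_mean tPi n0.
have [z' -> cvgz'] := @cvg_posterior_mean n.+1 _ tPi isT.
rewrite -EFinB abse_EFin lee_fin.
have cvgn : `|posterior_mean alpha theta M (Pi n.+1) - posterior_mean alpha theta M (Pi n)|
    @[M --> \oo] --> `|z' - z| by apply: cvg_norm; exact: cvgB.
apply: (cvgr_to_le cvgn); apply: nearW => M.
by apply: posterior_mean_increment => //; exact: tPi.2.
Qed.

End entropy_estimate.

Theorem proposition2 (R : realType) (alpha theta : R)
    (halpha : 0 <= alpha < 1) (htheta : - alpha < theta)
    (P : probability (ranked_simplex R) R) (hP : is_PDP alpha theta P)
    (d : measure_display) (T : measurableType d) (PP : probability T R)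
    (S : {RV PP >-> ranked_simplex R}) (X : nat -> {RV PP >-> R})
    (hS : forall A, measurable A -> distribution PP S A = P A)
    (hX : forall l U, measurable U ->
       distribution PP (X l) U = uniform_prob (@ltr01 R) U)
    (hXindep : mutually_independent X)
    (hSX : independent_of_sequence S X)
    (a : nat -> ranked_simplex R -> R) (ha : interval_placement a) :
  (ereal_sup [set `| entropy_estimate S X a n.+1 Pi
                     - entropy_estimate S X a n Pi |
             | n in [set n | (1 <= n)%N] & Pi in trajectory] < +oo)%E.
Proof.
rewrite (@le_lt_trans _ _ (2 / (1 - alpha) + 1)%:E) ?ltry//.
apply: ge_ereal_sup => _ [n n1 [Pi tPi <-]].
exact: (entropy_estimate_increment halpha htheta hP hS hX hXindep hSX ha).
Qed.
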